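(* Let $(I,C)$ be an $I^*$-algebra such that $C$ is abelian, and let $\hat C$ be the character space of $C$ with the weak-$*$ topology. Then $\hat C$, equipped with the partial order $\le_I$ defined by $m\le_I n\Leftrightarrow \forall c\in I,\ m(c)\le n(c)$, is a compact toposet, and the Gelfand transform $G:(I,C)\to (I(\hat C),\mathcal C(\hat C))$, $G(c)(m)=m(c)$, is an isometric isomorphism of $I^*$-algebras.
   Context: An ordered topological space is a set $M$ with a partial order $\le$ and a topology. A map $f$ between ordered sets is isotone if $x\le y\Rightarrow f(x)\le f(y)$. $I(M)$ is the set of continuous isotone functions $M\to\mathbb R$. A toposet (completely separated ordered space) is an ordered topological space $M$ such that for all $x,y\in M$: $x\le y\Leftrightarrow\forall f\in I(M),\ f(x)\le f(y)$. $\mathcal C(M)$ is the algebra of continuous functions $M\to\mathbb C$. For a unital $C^*$-algebra $C$, let $\mathrm{Re}\,C=\{a\in C: a=a^*\}$, $|a|=\sqrt{a^*a}$, and for $a,b\in\mathrm{Re}\,C$ put $a\wedge b=\frac{a+b}{2}-\frac{|a-b|}{2}$, $a\vee b=\frac{a+b}{2}+\frac{|a-b|}{2}$. A strong (resp. weak) pre-isocone of $C$ is a norm-closed subset $I\subset\mathrm{Re}\,C$ stable under addition and under multiplication by reals $\lambda\ge0$, containing $x1$ for all $x\in\mathbb R$, and such that $b\wedge b',b\vee b'\in I$ for all $b,b'\in I$ (resp. for all $b,b'\in I$ with $bb'=b'b$). It is an isocone if moreover its complex linear span is dense in $C$. A (strong or weak) $I^*$-algebra is a couple $(I,C)$ with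 $C$ a unital $C^*$-algebra and $I$ a (strong or weak) isocone of $C$; for abelian $C$ the two notions coincide. An isomorphism of $I^*$-algebras $(I,C)\to(I',C')$ is a $*$-isomorphism $\rho:C\to C'$ with $\rho(I)=I'$. Characters are unital $*$-morphisms $C\to\mathbb C$. *)

(* Defs.v *)
From HB Require Import structures.
From mathcomp Require Import all_boot all_order all_algebra.
From mathcomp Require Import complex.
From mathcomp Require Import all_classical all_reals all_analysis.

From mathcomp Require Import ring.

Set Implicit Arguments.
Unset Strict Implicit.
Unset Printing Implicit Defensive.

Import Order.TTheory GRing.Theory Num.Theory.
Import numFieldNormedType.Exports.

Local Open Scope classical_set_scope.
Local Open Scope complex_scope.
Local Open Scope ring_scope.

HB.instance Definition _ (R : realType) := NormedModule.copy R[i] R[i]^o.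


Lemma complex_complete (R : realType) (F : set_system R[i]) :
  ProperFilter F -> cauchy F -> cvg F.
Proof.
move=> FF Fc.
have aux (g : R[i] -> R^o) : (forall x y, `|g x - g y|%:C <= `|x - y|) ->
    cvg (g @ F).
  move=> gl; apply: cauchy_cvg; apply: cauchy_exP => e e0.
  have e0' : 0 < e%:C :> R[i] by rewrite ltcR.
  have /cauchyP/(_ _ e0') [x Fx] := Fc.
  exists (g x); rewrite /nbhs/=; apply: filterS Fx => y.
  rewrite -ball_normE /= -ball_normE /= => xy.
  by rewrite -ltcR; apply: le_lt_trans (gl _ _) xy.
have reL : forall x y : R[i], `|complex.Re x - complex.Re y|%:C <= `|x - y|.
  move=> x y; have := normc_ge_Re (x - y).
  by case: x y => [a b] [c d].
have imL : forall x y : R[i], `|complex.Im x - complex.Im y|%:C <= `|x - y|.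
  move=> x y; have := normc_ge_Re ((x - y) * 'i%C).
  rewrite ReiNIm normrN normrM (_ : `|'i%C| = 1) ?mulr1.
    by case: x y => [a b] [c d].
  by rewrite normc_def /= expr0n expr1n add0r sqrtr1.
have /cvg_ex [a Ha] := aux _ reL.
have /cvg_ex [b Hb] := aux _ imL.
apply/cvg_ex; exists (a +i* b).
apply/cvgrPdist_lt => /= e e0.
have er : e \is Num.real by rewrite gtr0_real.
have [r er'] : exists r, e = r%:C by apply/complex_realP.
have r0 : 0 < r by rewrite -ltcR -er'.
have r20 : 0 < r / 2 by rewrite divr_gt0.
move/cvgrPdist_lt/(_ _ r20): Ha; move/cvgrPdist_lt/(_ _ r20): Hb => Hb Ha.
near=> z.
have h1 : `|a - complex.Re z| < r / 2 by near: z.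
have h2 : `|b - complex.Im z| < r / 2 by near: z.
have -> : a +i* b - z = (a - complex.Re z)%:C + 'i%C * (b - complex.Im z)%:C :> R[i].
  by rewrite [LHS]complexE; case: (z).
apply: le_lt_trans (ler_normD _ _) _.
rewrite normrM (_ : `|'i%C| = 1) ?mul1r; last first.
  by rewrite normc_def /= expr0n expr1n add0r sqrtr1.
rewrite !normc_def /= expr0n /= !addr0 !sqrtr_sqr -rmorphD er' ltcR.
by rewrite [r]splitr ltrD.
Unshelve. all: by end_near. Qed.

HB.instance Definition _ (R : realType) :=
  Uniform_isComplete.Build R[i] (@complex_complete R).

(* Multiplication and unit are part of the mixin because no library structure
   joins a possibly trivial ring with a norm; the ring notations are recovered
   by the instance following the structure. The zero algebra is allowed. *)
HB.mixin Record isCStarAlgebra (R : realType) A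
    of CompleteNormedModule R[i] A := {
  cunit : A;
  cmul : A -> A -> A;
  star : A -> A;
  cmulA : associative cmul;
  cmul1x : left_id cunit cmul;
  cmulx1 : right_id cunit cmul;
  cmulDl : left_distributive cmul +%R;
  cmulDr : right_distributive cmul +%R;
  cmulZl : forall (l : R[i]) (x y : A), cmul (l *: x) y = l *: cmul x y;
  cmulZr : forall (l : R[i]) (x y : A), cmul x (l *: y) = l *: cmul x y;
  cnormM : forall x y : A, `|cmul x y| <= `|x| * `|y|;
  starK : involutive star;
  starD : {morph star : x y / x + y};
  starZ : forall (l : R[i]) (x : A), star (l *: x) = l^* *: star x;
  starM : forall x y : A, star (cmul x y) = cmul (star y) (star x);
  cstar_norm : forall x : A, `|cmul (star x) x| = `|x| ^+ 2
}.

#[short(type="cstarType")]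
HB.structure Definition CStarAlgebra (R : realType) :=
  {A of isCStarAlgebra R A & CompleteNormedModule R[i] A}.

#[non_forgetful_inheritance]
HB.instance Definition _ (R : realType) (A : cstarType R) :=
  GRing.Zmodule_isPzRing.Build A
    (@cmulA R A) (@cmul1x R A) (@cmulx1 R A) (@cmulDl R A) (@cmulDr R A).

Section ComplexCStar.
Variable R : realType.

Let normM (x y : R[i]) : `|x * y| <= `|x| * `|y|.
Proof. by rewrite normrM. Qed.

Let conjM (x y : R[i]) : (x * y)^* = y^* * x^*.
Proof. by rewrite rmorphM mulrC. Qed.

Let norm_conjM (x : R[i]) : `|x^* * x| = `|x| ^+ 2.
Proof. by rewrite normrM norm_conjC. Qed.

HB.instance Definition _ := @isCStarAlgebra.Build R R[i]
  1 *%R Num.conj (@mulrA _) (@mul1r _) (@mulr1 _) (@mulrDl _) (@mulrDr _)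
  (fun l x y => esym (mulrA l x y)) (fun l x y => mulrCA x l y)
  normM (@conjCK _) (rmorphD _) (rmorphM _) conjM norm_conjM.

End ComplexCStar.

(* The carrier depends on the compactness proof so that it can bear the sup
   norm. *)
Definition cfun (R : realType) (X : topologicalType)
  (cX : compact [set: X]) : Type := continuousType X R[i].

Section CfunAlgebra.
Context (R : realType) (X : topologicalType) (cX : compact [set: X]).
Local Notation CX := (cfun R cX).

Definition cfun_mk (f : X -> R[i]) (fc : continuous f) : CX :=
  [the continuousType X R[i] of mkcts fc].

Definition cfun_val (f : CX) : X -> R[i] := @Continuous.sort X R[i] f.
Coercion cfun_val : cfun >-> Funclass.

Lemma cfun_cts (f : CX) : continuous f.
Proof. exact: (@cts_fun X R[i] f). Qed.

Lemma cfunP (f g : CX) : f =1 g -> f = g.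
Proof. by move=> ?; apply/continuousEP. Qed.

HB.instance Definition _ := Choice.copy CX (continuousType X R[i]).

Let cst_cts (c : R[i]) : continuous (fun _ : X => c : R[i]).
Proof. by move=> x; exact: cvg_cst. Qed.

Let add_cts (f g : CX) : continuous (fun x : X => f x + g x : R[i]).
Proof. by move=> x; apply: cvgD; exact: cfun_cts. Qed.

Let opp_cts (f : CX) : continuous (fun x : X => - f x : R[i]).
Proof. by move=> x; apply: cvgN; exact: cfun_cts. Qed.

Let mul_cts (f g : CX) : continuous (fun x : X => f x * g x : R[i]).
Proof. by move=> x; apply: cvgM; exact: cfun_cts. Qed.

Let star_cts (f : CX) : continuous (fun x : X => (f x)^* : R[i]).
Proof.
move=> x; apply/cvgrPdist_lt => e e0; near=> y.
rewrite -rmorphB norm_conjC; near: y.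
by move/cvgrPdist_lt: (@cfun_cts f x); apply.
Unshelve. all: by end_near. Qed.

Definition cfun_cst (c : R[i]) : CX := cfun_mk (@cst_cts c).
Definition cfun_add (f g : CX) : CX := cfun_mk (@add_cts f g).
Definition cfun_opp (f : CX) : CX := cfun_mk (@opp_cts f).
Definition cfun_mul (f g : CX) : CX := cfun_mk (@mul_cts f g).
Definition cfun_scale (l : R[i]) (f : CX) : CX := cfun_mul (cfun_cst l) f.
Definition cfun_star (f : CX) : CX := cfun_mk (@star_cts f).

Let addA : associative cfun_add.
Proof. by move=> *; apply: cfunP => x; exact: addrA. Qed.

Let addC : commutative cfun_add.
Proof. by move=> *; apply: cfunP => x; exact: addrC. Qed.

Let add0 : left_id (cfun_cst 0) cfun_add.
Proof. by move=> *; apply: cfunP => x; exact: add0r. Qed.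

Let addN : left_inverse (cfun_cst 0) cfun_opp cfun_add.
Proof. by move=> *; apply: cfunP => x; exact: addNr. Qed.

HB.instance Definition _ :=
  @GRing.isZmodule.Build CX (cfun_cst 0) cfun_opp cfun_add addA addC add0 addN.

Let mulA : associative cfun_mul.
Proof. by move=> *; apply: cfunP => x; exact: mulrA. Qed.

Let mul1 : left_id (cfun_cst 1) cfun_mul.
Proof. by move=> *; apply: cfunP => x; exact: mul1r. Qed.

Let mulx1 : right_id (cfun_cst 1) cfun_mul.
Proof. by move=> *; apply: cfunP => x; exact: mulr1. Qed.

Let mulDl : left_distributive cfun_mul +%R.
Proof. by move=> *; apply: cfunP => x; exact: mulrDl. Qed.

Let mulDr : right_distributive cfun_mul +%R.
Proof. by move=> *; apply: cfunP => x; exact: mulrDr. Qed.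

HB.instance Definition _ :=
  GRing.Zmodule_isPzRing.Build CX mulA mul1 mulx1 mulDl mulDr.

Let scaleA : forall (a b : R[i]) f,
  cfun_scale a (cfun_scale b f) = cfun_scale (a * b) f.
Proof. by move=> *; apply: cfunP => x; exact: mulrA. Qed.

Let scaleDl : forall f, {morph cfun_scale^~ f : a b / a + b}.
Proof. move=> f a b; apply: cfunP => x; exact: mulrDl. Qed.

HB.instance Definition _ := @GRing.Zmodule_isLmodule.Build R[i] CX cfun_scale
  scaleA mul1 (fun l => mulDr (cfun_cst l)) scaleDl.

Let mulZl : forall (l : R[i]) (f g : CX),
  cfun_mul (l *: f) g = l *: cfun_mul f g.
Proof. by move=> *; apply: cfunP => x; exact: (esym (mulrA _ _ _)). Qed.

Let mulZr : forall (l : R[i]) (f g : CX),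
  cfun_mul f (l *: g) = l *: cfun_mul f g.
Proof. by move=> *; apply: cfunP => x; exact: mulrCA. Qed.

Let starI : involutive cfun_star.
Proof. by move=> *; apply: cfunP => x; exact: conjCK. Qed.

Let starA : {morph cfun_star : f g / f + g}.
Proof. by move=> *; apply: cfunP => x; exact: (rmorphD Num.conj). Qed.

Let starS : forall (l : R[i]) (f : CX),
  cfun_star (l *: f) = l^* *: cfun_star f.
Proof. by move=> *; apply: cfunP => x; exact: (rmorphM Num.conj). Qed.

Let starP : forall f g : CX,
  cfun_star (cfun_mul f g) = cfun_mul (cfun_star g) (cfun_star f).
Proof. by move=> *; apply: cfunP => x; exact: (etrans (rmorphM Num.conj _ _) (mulrC _ _)). Qed.

Definition cfun_norm (f : CX) : R[i] :=
  (sup [set complex.Re `|f x| | x in [set: X]])%:C.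

Let ReK (z : R[i]) : (complex.Re `|z|)%:C = `|z|.
Proof. by rewrite RRe_real// normr_real. Qed.

Let cfun_has_ub (f : CX) :
  has_ubound [set complex.Re `|f x| | x in [set: X]].
Proof.
pose g (x : X) : R := complex.Re `|f x|.
have gc : continuous g.
  move=> x; apply/cvgrPdist_lt => e e0; near=> y.
  rewrite -ltcR; have -> : `|g x - g y|%:C = `| `|f x| - `|f y| |.
    have -> : `|f x| - `|f y| = (g x - g y)%:C by rewrite rmorphB /= !ReK.
    by rewrite normc_def /= expr0n addr0 sqrtr_sqr.
  apply: le_lt_trans (ler_dist_dist _ _) _; near: y.
  by move/cvgrPdist_lt: (@cfun_cts f x); apply; rewrite ltcR.
have : compact (g @` [set: X]).
  by apply: continuous_compact => //; exact: continuous_subspaceT.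
move=> /compact_bounded [M [_ HM]].
exists (M + 1) => _ [x _ <-].
apply: le_trans (ler_norm _) _.
by apply: HM; [rewrite ltrDl|exists x].
Unshelve. all: by end_near. Qed.

Lemma cfun_norm_ge (f : CX) x : `|f x| <= cfun_norm f.
Proof.
rewrite -ReK lecR; apply: ub_le_sup; first exact: cfun_has_ub.
by exists x.
Qed.

Lemma cfun_norm_ge0 (f : CX) : 0 <= cfun_norm f.
Proof.
rewrite lecR; have [[x _]|X0] := pselect ([set: X] !=set0).
  apply: (@le_trans _ _ (complex.Re `|f x|)); first by rewrite -ler0c ReK.
  by apply: ub_le_sup; [exact: cfun_has_ub|exists x].
rewrite (_ : [set _ | _ in _] = set0) ?sup0//.
by apply/seteqP; split=> // y [x _ _]; case: X0; exists x.
Qed.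

Lemma cfun_norm_le (f : CX) (M : R[i]) :
  0 <= M -> (forall x, `|f x| <= M) -> cfun_norm f <= M.
Proof.
move=> M0 H; have MR : M \is Num.real by rewrite ger0_real.
rewrite -(RRe_real MR) lecR.
have [[x _]|X0] := pselect ([set: X] !=set0).
  apply: ge_sup; first by exists (complex.Re `|f x|); exists x.
  by move=> _ [y _ <-]; rewrite -lecR ReK (RRe_real MR).
rewrite (_ : [set _ | _ in _] = set0) ?sup0; first by rewrite -lecR RRe_real.
by apply/seteqP; split=> // y [x _ _]; case: X0; exists x.
Qed.

Let cfun_normD (f g : CX) : cfun_norm (f + g) <= cfun_norm f + cfun_norm g.
Proof.
apply: cfun_norm_le => [|x]; first by rewrite addr_ge0// cfun_norm_ge0.
by apply: le_trans (ler_normD _ _) _; apply: lerD; exact: cfun_norm_ge.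
Qed.

Let cfun_normM (f g : CX) :
  cfun_norm (cfun_mul f g) <= cfun_norm f * cfun_norm g.
Proof.
apply: cfun_norm_le => [|x]; first by rewrite mulr_ge0// cfun_norm_ge0.
by rewrite normrM; apply: ler_pM => //; exact: cfun_norm_ge.
Qed.

Let cfun_normZ (l : R[i]) (f : CX) : cfun_norm (l *: f) = `|l| * cfun_norm f.
Proof.
apply/eqP; rewrite eq_le; apply/andP; split.
  apply: cfun_norm_le => [|x]; first by rewrite mulr_ge0// cfun_norm_ge0.
  by rewrite normrM ler_wpM2l// cfun_norm_ge.
have [->|l0] := eqVneq l 0; first by rewrite normr0 mul0r cfun_norm_ge0.
have l0' : 0 < `|l| by rewrite normr_gt0.
rewrite -ler_pdivlMl//; apply: cfun_norm_le => [|x].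
  by rewrite mulr_ge0 ?invr_ge0// cfun_norm_ge0.
by rewrite ler_pdivlMl// -normrM; exact: (cfun_norm_ge (l *: f)).
Qed.

Let cfun_norm_eq0 (f : CX) : cfun_norm f = 0 -> f = 0.
Proof.
move=> f0; apply: cfunP => x; apply/eqP; rewrite -normr_le0 -f0.
exact: cfun_norm_ge.
Qed.

HB.instance Definition _ := @Lmodule_isNormed.Build R[i] CX cfun_norm
  cfun_normD cfun_normZ cfun_norm_eq0.

Let cfun_complete (F : set_system CX) :
  ProperFilter F -> cauchy F -> cvg F.
Proof.
move=> FF Fc.
have Fe (e : R[i]) : 0 < e -> exists f : CX, F (ball f e).
  by move=> e0; have /cauchyP/(_ _ e0) := Fc.
have ballx (f g : CX) e x : ball f e g -> `|f x - g x| < e.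
  rewrite -ball_normE /=; apply: le_lt_trans.
  exact: (cfun_norm_ge (f - g)).
have ptc (x : X) : cvg ((fun f : CX => f x) @ F).
  apply: cauchy_cvg; apply: cauchy_exP => e e0.
  have [f Ff] := Fe _ e0.
  exists (f x); rewrite /nbhs/=; apply: filterS Ff => g fg.
  by rewrite -ball_normE /=; exact: ballx.
pose g x := lim ((fun f : CX => f x) @ F).
have gF (f : CX) (e : R[i]) : F (ball f e) -> forall x, `|f x - g x| <= e.
  move=> Ff x; apply/ler_addgt0Pr => d d0.
  have Fd : F [set h | `|g x - h x| < d].
    by move/cvgrPdist_lt: (ptc x); apply.
  have [h [/= gh fh]] := filter_ex (filterI Fd Ff).
  rewrite -(subrK (h x) (f x)) -addrA.
  apply: le_trans (ler_normD _ _) _; apply: lerD; last by rewrite distrC ltW.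
  by apply: ltW; exact: ballx.
have gc : continuous g.
  move=> x; apply/cvgrPdist_lt => e e0.
  have e30 : 0 < e / 3 by rewrite divr_gt0.
  have [f /gF fg] := Fe _ e30.
  have /cvgrPdist_lt/(_ _ e30) := @cfun_cts f x.
  apply: filterS => y fxy.
  have -> : g x - g y = (g x - f x) + (f x - f y) + (f y - g y).
    by rewrite !addrA !subrK.
  apply: le_lt_trans (ler_normD _ _) _.
  rewrite (_ : e = e / 3 + e / 3 + e / 3); last first.
    by field.
  apply: ltr_leD; last exact: fg.
  apply: le_lt_trans (ler_normD _ _) _.
  by apply: ler_ltD => //; rewrite distrC; exact: fg.
apply/cvg_ex; exists (cfun_mk gc); apply/cvgrPdist_le => e e0.
have e20 : 0 < e / 2 by rewrite divr_gt0.
have [f Ff] := Fe _ e20.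
apply: filterS (Ff) => h fh; apply: cfun_norm_le => [|x]; first exact: ltW.
rewrite -[X in `|X|]/(g x - h x) -(subrK (f x) (g x)) -addrA.
apply: le_trans (ler_normD _ _) _; rewrite [e]splitr; apply: lerD.
  by rewrite distrC; exact: gF.
by apply: ltW; exact: ballx.
Qed.

HB.instance Definition _ := Uniform_isComplete.Build CX cfun_complete.

Let cfun_norm_star (f : CX) :
  `|cfun_mul (cfun_star f) f| = `|f| ^+ 2.
Proof.
apply/eqP; rewrite eq_le expr2; apply/andP; split.
  apply: le_trans (cfun_normM _ _) _; apply: ler_wpM2r.
    exact: cfun_norm_ge0.
  apply: cfun_norm_le => [|x]; first exact: cfun_norm_ge0.
  by rewrite norm_conjC; exact: cfun_norm_ge.
have N0 := cfun_norm_ge0 (cfun_mul (cfun_star f) f).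
rewrite -[leRHS]sqrtCK -expr2 ler_pXn2r ?nnegrE ?sqrtC_ge0 ?cfun_norm_ge0//.
apply: cfun_norm_le => [|x]; first by rewrite sqrtC_ge0.
rewrite -(@ler_pXn2r _ 2) ?nnegrE ?sqrtC_ge0// sqrtCK.
apply: le_trans (cfun_norm_ge (cfun_mul (cfun_star f) f) x).
by rewrite normrM norm_conjC expr2.
Qed.

HB.instance Definition _ := @isCStarAlgebra.Build R CX
  (cfun_cst 1) cfun_mul cfun_star mulA mul1 mulx1 mulDl mulDr mulZl mulZr
  cfun_normM starI starA starS starP cfun_norm_star.

End CfunAlgebra.

Arguments cfun_mk {R X cX f} fc.

Section CStarTheory.
Context (R : realType) (A : cstarType R).
Implicit Types (a b : A) (I : set A).

Definition selfadjoint : set A := [set a | star a = a].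

Definition invertible a : Prop := exists b, a * b = 1 /\ b * a = 1.

Definition spectrum a : set R[i] := [set l | ~ invertible (a - l *: (1 : A))].

Definition positive : set A :=
  [set a | selfadjoint a /\ spectrum a `<=` [set l | 0 <= l]].

(* The positive square root of a positive element exists and is unique; the
   value is junk outside of that case. *)
Definition csqrt a : A := get [set b | positive b /\ b * b = a].

Definition cabs a : A := csqrt (star a * a).

Definition cmeet a b : A :=
  (2^-1 : R[i]) *: (a + b) - (2^-1 : R[i]) *: cabs (a - b).

Definition cjoin a b : A :=
  (2^-1 : R[i]) *: (a + b) + (2^-1 : R[i]) *: cabs (a - b).

Definition complex_span I : set A :=
  [set v | exists n (l : 'I_n -> R[i]) (b : 'I_n -> A),
    (forall i, I (b i)) /\ v = \sum_(i < n) l i *: b i].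

Variant strength := Strong | Weak.

Record pre_isocone (s : strength) I : Prop := PreIsocone {
  pre_isocone_closed : closed I;
  pre_isocone_selfadjoint : I `<=` selfadjoint;
  pre_isocone_add : forall a b, I a -> I b -> I (a + b);
  pre_isocone_scale : forall (l : R) a, 0 <= l -> I a -> I (l%:C *: a);
  pre_isocone_const : forall x : R, I (x%:C *: (1 : A));
  pre_isocone_lattice : forall a b, I a -> I b ->
    (if s is Weak then a * b = b * a else True) ->
    I (cmeet a b) /\ I (cjoin a b)
}.

(* isocone s I says that the couple (I, A) is an I*-algebra. *)
Record isocone (s : strength) I : Prop := Isocone {
  isocone_pre : pre_isocone s I;
  isocone_dense : dense (complex_span I)
}.

End CStarTheory.

Record star_morphism (R : realType) (A B : cstarType R) (f : A -> B) : Prop :=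
  StarMorphism {
  star_morphism_linear : linear f;
  star_morphism_unit : f 1 = 1;
  star_morphism_mul : {morph f : a b / a * b};
  star_morphism_star : {morph f : a / star a}
}.

Definition star_isomorphism (R : realType) (A B : cstarType R) (f : A -> B) :=
  star_morphism f /\ bijective f.

Definition Istar_isomorphism (R : realType) (A B : cstarType R)
    (I : set A) (J : set B) (f : A -> B) : Prop :=
  star_isomorphism f /\ f @` I = J.

Section OrderedSpace.
Context (R : realType) (X : topologicalType) (le : rel X).

Definition isotone_cts (f : X -> R) : Prop :=
  continuous f /\ {homo f : x y / le x y >-> x <= y}.

Record toposet : Prop := Toposet {
  toposet_refl : reflexive le;
  toposet_anti : antisymmetric le;
  toposet_trans : transitive le;
  toposet_separated : forall x y : X,
    le x y <-> forall f, isotone_cts f -> f x <= f y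
}.

(* The isotone real functions, seen inside the complex-valued ones. *)
Definition isotone_cone (cX : compact [set: X]) : set (cfun R cX) :=
  [set f | exists2 g, isotone_cts g & forall x, f x = (g x)%:C].

End OrderedSpace.

Arguments isotone_cone R {X} le cX.

Section CharacterSpace.
Context (R : realType) (A : cstarType R).

Record character := Character {
  char_fun :> A -> R[i];
  char_morph : star_morphism char_fun
}.

HB.instance Definition _ := gen_eqMixin character.
HB.instance Definition _ := gen_choiceMixin character.

(* The weak-* topology: pointwise convergence on A. *)
HB.instance Definition _ := Topological.copy character
  (initial_topology (char_fun : character -> {ptws A -> R[i]})).

Lemma char_eval_cts (a : A) : continuous (fun m : character => m a).
Proof.
move=> m; apply: (@continuous_comp _ _ _
  (char_fun : character -> {ptws A -> R[i]}) (fun f => f a)).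
  exact: initial_continuous.
exact: proj_continuous.
Qed.

Definition char_le (I : set A) : rel character :=
  fun m n => `[< forall c, I c -> m c <= n c >].

Definition gelfand (cX : compact [set: character]) (a : A) : cfun R cX :=
  cfun_mk (@char_eval_cts a).

End CharacterSpace.

(* Main.v *)
Require Import Defs.
From HB Require Import structures.
From mathcomp Require Import all_boot all_order all_algebra.
From mathcomp Require Import complex.
From mathcomp Require Import all_classical all_reals all_analysis.
From mathcomp Require Import ring lra.
Import Order.TTheory GRing.Theory Num.Theory.
Import numFieldNormedType.Exports.
Local Open Scope classical_set_scope.
Local Open Scope ring_scope.

Set Implicit Arguments.
Unset Strict Implicit.
Unset Printing Implicit Defensive.

(** The Gelfand transform is shown to be isometric by order theory alone, with
    no resolvents and no quotients by maximal ideals.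

    Call square an element b * b with b selfadjoint. In a commutative
    C*-algebra the C*-identity gives |a a| <= |a a + b b| for selfadjoint a, b
    ([norm_square_leD]), and an iteration gives selfadjoint square roots of
    1 - c when |c| <= 1 ([sqrt_ball1]). Together they say that, for t >= |a|,
    a selfadjoint a is a square iff |t - a| <= t. Hence squares form a convex
    cone, closed under products, for which 1 is an order unit whose order norm
    is the norm of the algebra ([squareD], [squareM], [norm_sub_square],
    [norm_le_order]).

    Extend this cone to a maximal set Q stable under sums and products and not
    containing -1. Then Q is a total order, Archimedean because |c| - c is a
    square, so that each selfadjoint element lies at exactly one point of the
    real line; this defines a character ([total_char_morph]). Starting from
    the cone generated by the squares and by h - |h|, where h is the product
    of the adjoint of x by x, one obtains a character with |m x| >= |x|
    ([char_attains_norm]). Characters are contractions since |h| - h is a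
    square ([char_norm]). So the Gelfand transform is isometric, and the
    character space is compact because characters are uniformly bounded on
    each element ([compact_character]).

    The image is then found twice by the lattice form of the Stone-Weierstrass
    theorem ([kakutani_stone]): a lattice of continuous functions which can
    match f at any two points approximates f uniformly. For a closed convex
    cone S of selfadjoint elements that contains the real constants and whose
    Gelfand transforms form a lattice, matching f at m and n only requires
    some c in S with m c < n c whenever f m < f n; it exists as soon as f is
    isotone for the order defined by S ([isotone_realized]). For S the set of
    all selfadjoint elements this order is equality, and every continuous
    function is a Gelfand transform ([gelfand_surj]). This supplies inverses,
    so spectra are sets of values of characters and m (cabs x) = |m x|
    ([char_cabs]). Therefore the transforms of an isocone I form a lattice,
    and S := I yields exactly the isotone functions ([gelfand_image]).

    Points of a compact space are characters of its function algebra, so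
    [char_cabs] computes cabs in both algebras; the Gelfand transform
    thus preserves meets and joins, and carries the isocone axioms from I to
    its image ([isocone_image]). Density of the span of I makes the order on
    characters antisymmetric ([char_le_separates]). *)

(** * Scalars, adjoints and norms *)

Section CStarBasics.
Context (R : realType) (A : cstarType R).
Implicit Types (a b x y : A) (l m : R[i]).

(** Scaling is turned into multiplication by [scal l] so that ring
    identities, including those with scalars, are decided by [ring]. *)
Definition scal l : A := l *: (1 : A).

Lemma scalE l x : l *: x = scal l * x.
Proof. by rewrite -[in LHS](mul1r x); exact: esym (cmulZl _ _ _). Qed.

Fact scal_zmod : zmod_morphism scal.
Proof. by move=> l m; exact: scalerBl. Qed.

Fact scal_monoid : monoid_morphism scal.
Proof.
split=> [|l m]; first exact: scale1r.
by rewrite -scalE /scal scalerA.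
Qed.

HB.instance Definition _ := GRing.isZmodMorphism.Build _ _ scal scal_zmod.
HB.instance Definition _ := GRing.isMonoidMorphism.Build _ _ scal scal_monoid.

Lemma starDE x y : star (x + y) = star x + star y.
Proof. exact: starD. Qed.

Lemma starME x y : star (x * y) = star y * star x.
Proof. exact: starM. Qed.

Lemma star1 : star (1 : A) = 1.
Proof. by have := starME (star (1 : A)) 1; rewrite mulr1 starK mulr1 => <-. Qed.

Lemma star0 : star (0 : A) = 0.
Proof. by rewrite -[X in star X](scale0r (0 : A)) starZ rmorph0 scale0r. Qed.

Lemma starN x : star (- x) = - star x.
Proof. by rewrite -scaleN1r starZ rmorphN1 scaleN1r. Qed.

Lemma starB x y : star (x - y) = star x - star y.
Proof. by rewrite starDE starN. Qed.

Lemma star_scal l : star (scal l) = scal l^*.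
Proof. by rewrite /scal starZ star1. Qed.

Lemma star_real l : 0 <= l -> star (scal l) = scal l.
Proof. by move=> l0; rewrite star_scal conj_Creal// ger0_real. Qed.

Lemma normM x y : `|x * y| <= `|x| * `|y|.
Proof. exact: cnormM. Qed.

Lemma norm_starM x : `|star x * x| = `|x| ^+ 2.
Proof. exact: cstar_norm. Qed.

Lemma norm_star x : `|star x| = `|x|.
Proof.
have le y : `|y| <= `|star y|.
  have [->|y0] := eqVneq y 0; first by rewrite normr0.
  by rewrite -(ler_pM2r (x := `|y|)) ?normr_gt0// -expr2 -norm_starM normM.
by apply/eqP; rewrite eq_le le -{2}(starK x) le.
Qed.

Lemma norm_sa a : star a = a -> `|a * a| = `|a| ^+ 2.
Proof. by move=> {1}<-; exact: norm_starM. Qed.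

Lemma norm1_le1 : `|1 : A| <= 1.
Proof.
have n2 : `|1 : A| = `|1 : A| ^+ 2 by rewrite -(norm_sa star1) mulr1.
have [->|n0] := eqVneq `|1 : A| 0; first exact: ler01.
suff -> : `|1 : A| = 1 by [].
by apply: (mulfI n0); rewrite -expr2 -n2 mulr1.
Qed.

Lemma norm_scal l : `|scal l| <= `|l|.
Proof. by rewrite /scal normrZ ler_piMr// norm1_le1. Qed.

Lemma norm_scal_ge0 l : 0 <= l -> `|scal l| <= l.
Proof. by move=> l0; apply: le_trans (norm_scal l) _; rewrite ger0_norm. Qed.

Lemma norm_scalM l x : `|scal l * x| = `|l| * `|x|.
Proof. by rewrite -scalE normrZ. Qed.

End CStarBasics.

(** * Square roots *)

Section SquareRoot.
Context (R : realType) (A : cstarType R) (hC : forall a b : A, a * b = b * a).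
#[local] HB.instance Definition _ := GRing.PzRing_hasCommutativeMul.Build A hC.
Local Open Scope complex_scope.

(** When [h] is one half, a fixed point d satisfies 2 d = c + d d, that is,
    (1 - d) (1 - d) = 1 - c. The ring is arbitrary so that the iteration in
    the algebra can be compared with the one over the reals at c = 1. *)
Definition sqrt_step (B : pzRingType) (h c d : B) : B := h * (c + d * d).

Definition sqrt_iter (B : pzRingType) (h c : B) n : B :=
  iter n (sqrt_step h c) 0.

Let u : nat -> R := sqrt_iter (2^-1 : R) 1.

Let uS n : u n.+1 = 2^-1 * (1 + u n * u n).
Proof. by []. Qed.

Let u_bound n : 0 <= u n <= 1.
Proof.
elim: n => [|n /andP[u0 u1]]; first by rewrite lexx ler01.
have uu0 : 0 <= u n * u n by rewrite mulr_ge0.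
have uu1 : u n * u n <= 1 by rewrite mulr_ile1.
by rewrite uS; apply/andP; split; lra.
Qed.

Let u_incr n : u n <= u n.+1.
Proof.
by rewrite uS; have := sqr_ge0 (1 - u n); rewrite expr2; nra.
Qed.

Let u_cvg : cvgn u.
Proof.
apply: nondecreasing_is_cvgn.
  by apply/nondecreasing_seqP => n; exact: u_incr.
by exists 1 => _ [n _ <-]; have /andP[] := u_bound n.
Qed.

(** The iterates [d n] are dominated by the real iterates [u n] for c = 1, and
    so are their increments: both bounds propagate through
    d n.+2 - d n.+1 = h (d n.+1 - d n) (d n.+1 + d n). As [u] is increasing and
    bounded by 1, it converges, hence [d] is Cauchy. *)
Lemma sqrt_ball1 (c : A) : star c = c -> `|c| <= 1 ->
  exists d, [/\ star d = d, `|d| <= 1 & (1 - d) * (1 - d) = 1 - c].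
Proof.
move=> cs c1; pose h : A := scal A 2^-1; pose d : nat -> A := sqrt_iter h c.
have h_norm x : `|h * x| = 2^-1 * `|x|.
  by rewrite norm_scalM ger0_norm// invr_ge0.
have hh : h + h = 1.
  by rewrite -rmorphD (_ : 2^-1 + 2^-1 = 1) ?rmorph1//; field.
have hs : star h = h by rewrite star_real// invr_ge0.
have uE n : (u n.+1)%:C = 2^-1 * (1 + (u n)%:C * (u n)%:C) :> R[i].
  by rewrite uS rmorphM rmorphD rmorph1 rmorphM fmorphV rmorph_nat.
have dS n : d n.+1 = h * (c + d n * d n) by [].
have d_sa n : star (d n) = d n.
  elim: n => [|n IH] /=; first exact: star0.
  by rewrite /sqrt_step -/(d n) starME starDE starME IH hs cs hC.
have d_norm n : `|d n| <= (u n)%:C.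
  elim: n => [|n IH] /=; first by rewrite normr0.
  rewrite -/(d n) -/(u n) uE /sqrt_step h_norm ler_pM2l ?invr_gt0//.
  apply: le_trans (ler_normD _ _) _; apply: lerD => //.
  by apply: le_trans (normM _ _) _; apply: ler_pM.
have d_step n : `|d n.+1 - d n| <= (u n.+1 - u n)%:C.
  elim: n => [|n IH].
    rewrite [d 0%N]/= [u 0%N]/= !subr0 uE [d 1%N]/= /sqrt_step h_norm.
    by rewrite ler_pM2l ?invr_gt0// !mul0r !addr0.
  have -> : d n.+2 - d n.+1 = h * ((d n.+1 - d n) * (d n.+1 + d n)).
    by rewrite [d n.+2]dS [X in _ - X = _]dS; ring.
  have -> : u n.+2 - u n.+1 = 2^-1 * ((u n.+1 - u n) * (u n.+1 + u n)).
    by rewrite [u n.+2]uS [X in _ - X = _]uS; ring.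
  rewrite h_norm rmorphM fmorphV rmorph_nat ler_pM2l ?invr_gt0//.
  rewrite rmorphM [X in _ <= _ * X]rmorphD.
  apply: le_trans (normM _ _) _; apply: ler_pM => //.
  by apply: le_trans (ler_normD _ _) _; apply: lerD.
have d_dist n k : `|d (n + k)%N - d n| <= (u (n + k)%N - u n)%:C.
  elim: k => [|k IH]; first by rewrite addn0 !subrr normr0.
  rewrite addnS -(subrK (d (n + k)%N) (d _.+1)) -addrA.
  apply: le_trans (ler_normD _ _) _.
  rewrite -(subrK (u (n + k)%N) (u _.+1)) -[X in _ <= X%:C]addrA rmorphD.
  exact: lerD.
have d_close (e : R[i]) : 0 < e ->
    exists n, forall m, (n <= m)%N -> `|d n - d m| < e.
  move=> e0; have eR : e = (complex.Re e)%:C by rewrite RRe_real// gtr0_real.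
  have e0' : 0 < complex.Re e by rewrite -ltcR -eR.
  have /cvgrPdist_lt/(_ _ e0') [n _ nP] := u_cvg.
  exists n => m nm; rewrite distrC -(subnKC nm) eR.
  apply: le_lt_trans (d_dist _ _) _; rewrite subnKC// ltcR.
  apply: le_lt_trans (nP n (leqnn n)); apply: le_trans (ler_norm _).
  rewrite lerD2r; apply: nondecreasing_cvgn_le u_cvg _.
  by apply/nondecreasing_seqP => k; exact: u_incr.
have d_cvg : cvgn d.
  apply: cauchy_cvg; apply: cauchy_exP => e e0.
  have [n nP] := d_close _ e0; exists (d n).
  exists n => // m /= nm; rewrite -ball_normE /=; exact: nP.
pose d' : A := lim (d @ \oo); have d'E : d @ \oo --> d' by exact: d_cvg.
have d'_close (e : R[i]) : 0 < e ->
    exists n, `|d' - d n| <= e /\ `|d' - d n.+1| <= e.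
  move=> e0; move/cvgrPdist_le/(_ _ e0): d'E => -[n _ nP].
  by exists n; split; apply: nP => /=.
have small (x : A) (k : R[i]) : 0 < k ->
    (forall e, 0 < e -> `|x| <= k * e) -> x = 0.
  move=> k0 xk; apply/eqP; rewrite -normr_le0; apply/ler_addgt0Pl => e e0.
  rewrite addr0; have -> : e = k * (e / k) by rewrite mulrC divfK// gt_eqF.
  by rewrite xk// divr_gt0.
have d'1 : `|d'| <= 1.
  apply/ler_addgt0Pr => e e0; have [n [ne _]] := d'_close _ e0.
  rewrite -(subrK (d n) d') addrC; apply: le_trans (ler_normD _ _) _.
  apply: lerD => //; apply: le_trans (d_norm n) _.
  by rewrite lecR; have /andP[] := u_bound n.
have d'E2 : d' = h * (c + d' * d').
  apply/eqP; rewrite -subr_eq0; apply/eqP; apply: (small _ 2) => // e e0.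
  have [n [ne n1e]] := d'_close _ e0.
  have -> : d' - h * (c + d' * d') =
      (d' - d n.+1) - h * ((d' - d n) * (d' + d n)).
    by rewrite [d n.+1]dS; ring.
  apply: le_trans (ler_normB _ _) _.
  rewrite (_ : 2 * e = e + 2^-1 * (e * (1 + 1))); last by field.
  apply: lerD => //; rewrite h_norm ler_pM2l ?invr_gt0//.
  apply: le_trans (normM _ _) _; apply: ler_pM => //.
  apply: le_trans (ler_normD _ _) _; apply: lerD => //.
  apply: le_trans (d_norm n) _.
  by rewrite lecR; have /andP[] := u_bound n.
exists d'; split=> //.
  apply/eqP; rewrite -subr_eq0; apply/eqP; apply: (small _ 2) => // e e0.
  have [n [ne _]] := d'_close _ e0.
  have -> : star d' - d' = star (d' - d n) - (d' - d n).
    by rewrite starB d_sa; ring.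
  apply: le_trans (ler_normB _ _) _; rewrite norm_star mulr_natl mulr2n.
  exact: lerD.
have dd : d' + d' = c + d' * d'.
  by rewrite {1 2}d'E2 -mulrDl hh mul1r.
have -> : (1 - d') * (1 - d') = 1 - (d' + d') + d' * d' by ring.
by rewrite dd; ring.
Qed.

End SquareRoot.

(** * The cone of squares *)

Section Squares.
Context (R : realType) (A : cstarType R) (hC : forall a b : A, a * b = b * a).
#[local] HB.instance Definition _ := GRing.PzRing_hasCommutativeMul.Build A hC.
Implicit Types (a b c d x y : A) (l t : R[i]).

Definition square : set A := [set a | exists2 b, star b = b & a = b * b].

Lemma sa_mul a b : star a = a -> star b = b -> star (a * b) = a * b.
Proof. by move=> sa sb; rewrite starME sa sb mulrC. Qed.

Lemma square_sa a : square a -> star a = a.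
Proof. by case=> b sb ->; exact: sa_mul. Qed.

Lemma scal_i2 : scal A 'i * scal A 'i = -1.
Proof. by rewrite -rmorphM -expr2 sqrCi rmorphN1. Qed.

(** With x := a + 'i b, the C*-identity makes |x| ^+ 2 the right-hand side,
    and a is the average of x and its adjoint, which have the same norm. *)
Lemma norm_square_leD a b : star a = a -> star b = b ->
  `|a * a| <= `|a * a + b * b|.
Proof.
move=> sa sb; pose x := a + scal A 'i * b.
have xs : star x = a - scal A 'i * b.
  by rewrite starDE starME sa sb star_scal conjCi rmorphN; ring.
have <- : star x * x = a * a + b * b.
  rewrite xs; have -> : a * a + b * b = a * a - (-1) * (b * b) by ring.
  by rewrite -scal_i2 /x; ring.
rewrite norm_sa// norm_starM ler_pXn2r ?nnegrE//.
have -> : a = scal A 2^-1 * (x + star x).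
  rewrite xs; have -> : x + (a - scal A 'i * b) = scal A 2%:R * a.
    by rewrite /x rmorph_nat; ring.
  by rewrite mulrA -rmorphM mulVf// rmorph1 mul1r.
rewrite norm_scalM ger0_norm ?invr_ge0// ler_pdivrMl//.
by apply: le_trans (ler_normD _ _) _; rewrite norm_star mulr_natl mulr2n.
Qed.

(** The explicit form of the root shows that characters are nonnegative on it,
    because they are at most 1 on d. *)
Lemma ball_sqrt a t : 0 <= t -> star a = a -> `|scal A t - a| <= t ->
  exists s d, [/\ 0 <= s, star d = d, `|d| <= 1 &
                  a = (scal A s * (1 - d)) * (scal A s * (1 - d))].
Proof.
rewrite le_eqVlt => /predU1P[<-|t0] sa at_.
  exists 0, 0; split => //; [exact: star0 | by rewrite normr0|].
  move: at_; rewrite rmorph0 sub0r normrN normr_le0 => /eqP ->.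
  by rewrite !mul0r.
have [||d [sd d1 dE]] := sqrt_ball1 hC (c := scal A t^-1 * (scal A t - a)).
- by rewrite sa_mul ?starB ?sa ?star_real ?invr_ge0 ?ltW.
- by rewrite norm_scalM ger0_norm ?invr_ge0 ?(ltW t0)// ler_pdivrMl// mulr1.
exists (sqrtC t), d; split => //; first by rewrite sqrtC_ge0 ltW.
have -> : scal A (sqrtC t) * (1 - d) * (scal A (sqrtC t) * (1 - d)) =
  scal A (sqrtC t ^+ 2) * ((1 - d) * (1 - d)) by ring.
rewrite dE sqrtCK.
have -> : scal A t * (1 - scal A t^-1 * (scal A t - a)) =
  scal A t - scal A (t * t^-1) * (scal A t - a) by ring.
by rewrite divff ?gt_eqF// rmorph1; ring.
Qed.

Lemma ball_square a t : 0 <= t -> star a = a -> `|scal A t - a| <= t ->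
  square a.
Proof.
move=> t0 sa /(ball_sqrt t0 sa) [s [d [s0 sd _ ->]]].
exists (scal A s * (1 - d)) => //.
by rewrite sa_mul ?star_real// starB star1 sd.
Qed.

(** The converse of [ball_square]: t - a is itself a square e e by
    [ball_square], and |e e| <= |e e + a|, which is the norm of the scalar t. *)
Lemma square_ball a t : square a -> `|a| <= t -> `|scal A t - a| <= t.
Proof.
move=> sqa at_; have t0 : 0 <= t by apply: le_trans at_.
have sa := square_sa sqa; have [b sb ab] := sqa.
have [||e se eE] := @ball_square (scal A t - a) t t0.
- by rewrite starB sa star_real.
- by rewrite (_ : _ - _ = a) //; ring.
rewrite eE; apply: le_trans (norm_square_leD se sb) _.
by rewrite -eE -ab subrK norm_scal_ge0.
Qed.

Lemma squareD a b : square a -> square b -> square (a + b).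
Proof.
move=> sqa sqb; apply: (@ball_square _ (`|a| + `|b|)); first exact: addr_ge0.
  by rewrite starDE !square_sa.
have -> : scal A (`|a| + `|b|) - (a + b) = (scal A `|a| - a) +
  (scal A `|b| - b).
  by ring.
by apply: le_trans (ler_normD _ _) _; apply: lerD; exact: square_ball.
Qed.

Lemma squareM a b : square a -> square b -> square (a * b).
Proof.
move=> [c sc ->] [d sd ->]; exists (c * d); first exact: sa_mul.
by ring.
Qed.

Lemma square_scal t : 0 <= t -> square (scal A t).
Proof.
move=> t0; exists (scal A (sqrtC t)); first by rewrite star_real// sqrtC_ge0.
by rewrite -rmorphM -expr2 sqrtCK.
Qed.

Lemma norm_sub_square a : star a = a -> square (scal A `|a| - a).
Proof.
move=> sa; apply: (@ball_square _ `|a|) => //.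
  by rewrite starB sa star_real.
by rewrite (_ : _ - _ = a) //; ring.
Qed.

Lemma norm_le_order a t : 0 <= t -> square a -> square (scal A t - a) ->
  `|a| <= t.
Proof.
move=> t0 [b sb ab] [e se eE]; rewrite ab.
by apply: le_trans (norm_square_leD sb se) _; rewrite -ab -eE subrKC
  norm_scal_ge0.
Qed.

(** Orderings of the selfadjoint part, given by their cones of nonnegative
    elements. *)
Record preordering (Q : set A) : Prop := Preordering {
  preordering_sa : forall a, Q a -> star a = a;
  preordering_sq : square `<=` Q;
  preorderingD : forall a b, Q a -> Q b -> Q (a + b);
  preorderingM : forall a b, Q a -> Q b -> Q (a * b);
  preordering_proper : ~ Q (-1)
}.

(** Zorn is applied to the sets X such that T `|` X is a preordering, so that
    the empty chain has the upper bound set0. *)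
Lemma maximal_preordering T : preordering T -> exists Q, [/\ preordering Q,
  T `<=` Q & forall Q', preordering Q' -> Q `<=` Q' -> Q' `<=` Q].
Proof.
move=> preT; pose P (X : set A) := preordering (T `|` X).
have [F FP Ftot|Q [preQ maxQ]] := @Zorn_bigcup A P.
  have pick2 a b : (T `|` \bigcup_(X in F) X) a -> (T `|` \bigcup_(X in F) X)
    b ->
      exists X, [/\ preordering (T `|` X), (T `|` X) a, (T `|` X) b &
         T `|` X `<=` T `|` \bigcup_(X in F) X].
    have sub X : F X -> T `|` X `<=` T `|` \bigcup_(X in F) X.
      by move=> FX; apply: setUS; exact: bigcup_sup.
    move=> [Ta|[X FX Xa]] [Tb|[Y FY Yb]].
    - by exists set0; rewrite setU0; split => //; exact: subsetUl.
    - by exists Y; split; [exact: FP|left|right|exact: sub].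
    - by exists X; split; [exact: FP|right|left|exact: sub].
    - have [XY|YX] := Ftot X Y FX FY.
        by exists Y; split; [exact: FP|right; exact: XY|right|exact: sub].
      by exists X; split; [exact: FP|right|right; exact: YX|exact: sub].
  split.
  - by move=> a /[dup] /pick2 /[apply] -[X [pX Xa _ _]];
      exact: preordering_sa pX _ Xa.
  - by move=> a /(preordering_sq preT); left.
  - by move=> a b /pick2 /[apply] -[X [pX Xa Xb]]; apply; exact: preorderingD.
  - by move=> a b /pick2 /[apply] -[X [pX Xa Xb]]; apply; exact: preorderingM.
  - by move=> /[dup] /pick2 /[apply] -[X [pX Xa _ _]];
      exact: preordering_proper pX Xa.
exists (T `|` Q); split => // Q' preQ' QQ'; apply: contrapT => nQ'.
have TQ' : T `|` Q' = Q' by apply: setUidr => a Ta; apply: QQ'; left.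
apply: (maxQ Q'); last by rewrite /P TQ'.
rewrite properEneq; split; last by move=> a Qa; apply: QQ'; right.
apply/eqP => QE; apply: nQ' => a; rewrite -QE; right => //.
Qed.

End Squares.

(** * Real and imaginary parts *)

Section RealImaginaryParts.
Context (R : realType) (A : cstarType R) (hC : forall a b : A, a * b = b * a).
#[local] HB.instance Definition _ := GRing.PzRing_hasCommutativeMul.Build A hC.
Implicit Types (a b x y : A).

Definition re_part x : A := scal A 2^-1 * (x + star x).
Definition im_part x : A := re_part (- (scal A 'i * x)).

Let half2 x : scal A 2^-1 * (x + x) = x.
Proof.
have -> : x + x = scal A 2 * x by rewrite rmorph_nat; ring.
by rewrite mulrA -rmorphM mulVf// rmorph1 mul1r.
Qed.

Let star_i x : star (scal A 'i * x) = - (scal A 'i * star x).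
Proof. by rewrite starME star_scal conjCi rmorphN; ring. Qed.

Lemma re_part_sa x : star (re_part x) = re_part x.
Proof.
apply: sa_mul => //; first by rewrite star_real// invr_ge0.
by rewrite starDE starK addrC.
Qed.

Lemma re_im_partE x : x = re_part x + scal A 'i * im_part x.
Proof.
rewrite /im_part /re_part starN star_i opprK.
have -> : scal A 'i * (scal A 2^-1 * (- (scal A 'i * x) + scal A 'i * star x)) =
  scal A 2^-1 * ((scal A 'i * scal A 'i) * (star x - x)) by ring.
rewrite scal_i2 -mulrDr.
by have -> : x + star x + -1 * (star x - x) = x + x by ring.
Qed.

Lemma re_part_cart a b : star a = a -> star b = b ->
  re_part (a + scal A 'i * b) = a.
Proof.
move=> sa sb; rewrite /re_part starDE star_i sa sb -[RHS]half2.
by congr (_ * _); ring.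
Qed.

Lemma im_part_cart a b : star a = a -> star b = b ->
  im_part (a + scal A 'i * b) = b.
Proof.
move=> sa sb; rewrite /im_part.
have -> : - (scal A 'i * (a + scal A 'i * b)) = b + scal A 'i * (- a).
  transitivity (- ((scal A 'i * scal A 'i) * b) + scal A 'i * (- a));
    first ring.
  by rewrite scal_i2; ring.
by rewrite re_part_cart// starN sa.
Qed.

Lemma cartesian x :
  exists a b, [/\ star a = a, star b = b & x = a + scal A 'i * b].
Proof.
exists (re_part x), (im_part x).
by split; [exact: re_part_sa|exact: re_part_sa|exact: re_im_partE].
Qed.

End RealImaginaryParts.

(** * The character of a maximal preordering *)

Section TotalPreordering.
Context (R : realType) (A : cstarType R) (hC : forall a b : A, a * b = b * a).
#[local] HB.instance Definition _ := GRing.PzRing_hasCommutativeMul.Build A hC.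
Local Open Scope complex_scope.
Implicit Types (a b c d x y : A) (r s e : R).

Definition rscal r : A := scal A r%:C.

Fact rscal_zmod : zmod_morphism rscal.
Proof. by move=> r s; rewrite /rscal !rmorphB. Qed.

Fact rscal_monoid : monoid_morphism rscal.
Proof. by split=> [|r s]; rewrite /rscal ?rmorph1// !rmorphM. Qed.

HB.instance Definition _ := GRing.isZmodMorphism.Build _ _ rscal rscal_zmod.
HB.instance Definition _ := GRing.isMonoidMorphism.Build _ _ rscal rscal_monoid.

Lemma star_rscal r : star (rscal r) = rscal r.
Proof. by rewrite /rscal star_scal conj_Creal// complex_real. Qed.

Lemma square_rscal r : 0 <= r -> square (rscal r).
Proof. by move=> r0; apply: square_scal => //; rewrite ler0c. Qed.

Variable Q : set A.
Hypotheses (preQ : preordering Q)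
  (maxQ : forall Q', preordering Q' -> Q `<=` Q' -> Q' `<=` Q).

Let Qsq := preordering_sq preQ.
Let QD := preorderingD preQ.
Let QM := preorderingM preQ.
Let Qsa := preordering_sa preQ.

Let Qr r : 0 <= r -> Q (rscal r).
Proof. by move=> r0; apply: Qsq; exact: square_rscal. Qed.

Let Qr_ge0 r : Q (rscal r) -> 0 <= r.
Proof.
move=> Qr'; rewrite leNgt; apply/negP => r0; apply: (preordering_proper preQ).
have -> : -1 = rscal (- r^-1) * rscal r.
  by rewrite -rmorphM mulNr mulVf ?lt_eqF// rmorphN1.
by apply: QM => //; apply: Qr; rewrite oppr_ge0 invr_le0 ltW.
Qed.

(** If neither c nor - c can be added to Q, then -1 = p + c q and
    -1 = p' - c q' with p, q, p', q' in Q. Multiplying 1 + p by 1 + p' yields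
    -1 = p + p' + p p' + c c q q', an element of Q. *)
Let Qtotal c : star c = c -> Q c \/ Q (- c).
Proof.
move=> sc; pose adj k := [set x | exists p q, [/\ Q p, Q q & x = p + k * q]].
have Q0 : Q 0 by rewrite -(rmorph0 rscal); exact: Qr.
have Q1 : Q 1 by rewrite -(rmorph1 rscal); exact: Qr.
have adjP k : star k = k -> ~ adj k (-1) -> Q k.
  move=> sk nk; apply: (maxQ (Q' := adj k)).
  - split => //.
    + by move=> _ [p [q [Qp Qq ->]]]; rewrite starDE (Qsa Qp)
        (sa_mul hC sk (Qsa Qq)).
    + by move=> a /Qsq Qa; exists a, 0; split => //; ring.
    + move=> _ _ [p [q [Qp Qq ->]]] [p' [q' [Qp' Qq' ->]]].
      by exists (p + p'), (q + q'); split; [exact: QD|exact: QD|ring].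
    + move=> _ _ [p [q [Qp Qq ->]]] [p' [q' [Qp' Qq' ->]]].
      exists (p * p' + (k * k) * (q * q')), (p * q' + q * p'); split.
      * by apply: QD; apply: QM => //; [apply: Qsq; exists k|exact: QM].
      * by apply: QD; exact: QM.
      * by ring.
  - by move=> a Qa; exists a, 0; split => //; ring.
  - by exists 0, 1; split => //; ring.
have [[p [q [Qp Qq pq]]]|] := pselect (adj c (-1)); last by move/(adjP _ sc);
  left.
have [[p' [q' [Qp' Qq' pq']]]|] := pselect (adj (- c) (-1)); last first.
  by move/adjP; rewrite starN sc => /(_ erefl); right.
exfalso; apply: (preordering_proper preQ).
have e1 : 1 + p = - (c * q) by rewrite -[1]opprK pq; ring.
have e2 : 1 + p' = c * q' by rewrite -[1]opprK pq'; ring.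
have e3 : (1 + p) * (1 + p') = - (c * c * (q * q')) by rewrite e1 e2; ring.
have -> : -1 = (p + p' + p * p') + c * c * (q * q').
  have -> : p + p' + p * p' = (1 + p) * (1 + p') - 1 by ring.
  by rewrite e3; ring.
apply: QD; first by apply: QD; [exact: QD|exact: QM].
by apply: QM; [apply: Qsq; exists c|exact: QM].
Qed.

(** The point r of the real line at which c lies in the order of Q. It is given
    by a relation rather than by a supremum so that its compatibility with the
    ring operations is a direct manipulation of inequalities. *)
Definition has_value c r := forall e, 0 < e ->
  Q (c - rscal (r - e)) /\ Q (rscal (r + e) - c).

(** The supremum of the r below c works, by totality of Q. The norm bounds
    this set because |c| - c and |c| + c are squares. *)
Lemma value_exists c : star c = c -> exists r, has_value c r.
Proof.
move=> sc; pose n := complex.Re `|c|.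
have nE : rscal n = scal A `|c| by rewrite /rscal RRe_real// normr_real.
have Qnc : Q (rscal n - c) by rewrite nE; apply: Qsq;
  exact: (norm_sub_square hC).
have Qcn : Q (c + rscal n).
  have := @norm_sub_square _ _ hC (- c).
  by rewrite normrN opprK starN sc -nE addrC => /(_ erefl); exact: Qsq.
pose S := [set r | Q (c - rscal r)].
have Sn r : S r -> r <= n.
  move=> Sr; rewrite -subr_ge0; apply: Qr_ge0.
  have -> : rscal (n - r) = (rscal n - c) + (c - rscal r) by ring.
  exact: QD.
have Ssup : has_sup S.
  split; last by exists n => r; exact: Sn.
  by exists (- n); rewrite /S /= rmorphN opprK.
exists (sup S) => e e0; split.
  have [r Sr er] := sup_adherent e0 Ssup.
  have -> : c - rscal (sup S - e) = (c - rscal r) +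
    rscal (r - (sup S - e)) by ring.
  by apply: QD => //; apply: Qr; rewrite subr_ge0 ltW.
have [|//|] := @Qtotal (rscal (sup S + e) - c); first by rewrite starB sc
  star_rscal.
rewrite opprB => Se; have := ub_le_sup Ssup.2 Se.
by rewrite gerDl leNgt e0.
Qed.

Lemma value_ge0 c r : Q c -> has_value c r -> 0 <= r.
Proof.
move=> Qc cr; apply/ler_addgt0Pr => e e0; apply: Qr_ge0.
have -> : rscal (r + e) = c + (rscal (r + e) - c) by ring.
by apply: QD => //; exact: (cr e e0).2.
Qed.

Lemma valueN c r : has_value c r -> has_value (- c) (- r).
Proof.
move=> cr e e0; have [lo hi] := cr e e0; split.
  by rewrite (_ : _ - _ = rscal (r + e) - c) //; ring.
by rewrite (_ : _ - _ = c - rscal (r - e)) //; ring.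
Qed.

Lemma valueD c d r s : has_value c r -> has_value d s ->
  has_value (c + d) (r + s).
Proof.
move=> cr ds e e0; have e20 : 0 < e / 2 by rewrite divr_gt0.
have [clo chi] := cr _ e20; have [dlo dhi] := ds _ e20.
have eE : e = e / 2 + e / 2 by rewrite -splitr.
split; rewrite eE.
  have -> : c + d - rscal (r + s - (e / 2 + e / 2)) =
    (c - rscal (r - e / 2)) + (d - rscal (s - e / 2)) by ring.
  exact: QD.
have -> : rscal (r + s + (e / 2 + e / 2)) - (c + d) =
    (rscal (r + e / 2) - c) + (rscal (s + e / 2) - d) by ring.
exact: QD.
Qed.

Lemma value_rscal r : has_value (rscal r) r.
Proof. by move=> e e0; rewrite -!rmorphB; split; apply: Qr; lra. Qed.

Lemma value_unique c r s : has_value c r -> has_value c s -> r = s.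
Proof.
have le c' r' s' : has_value c' r' -> has_value c' s' -> r' <= s'.
  move=> cr cs; rewrite -subr_ge0 addrC; apply: (@value_ge0 0).
    by rewrite -(rmorph0 rscal); exact: Qr.
  by rewrite -(addNr c'); apply: valueD => //; exact: valueN.
by move=> cr cs; apply/eqP; rewrite eq_le (le c)// (le c).
Qed.

Let Qhalf x : Q (rscal 2 * x) -> Q x.
Proof.
move=> Q2; have -> : x = rscal 2^-1 * (rscal 2 * x).
  by rewrite mulrA -rmorphM mulVf// rmorph1 mul1r.
by apply: QM => //; apply: Qr; rewrite invr_ge0.
Qed.

Let value0M_lo c d : has_value c 0 -> has_value d 0 -> forall e, 0 < e ->
  Q (c * d + rscal (e * e)).
Proof.
move=> c0 d0 e e0; have [clo chi] := c0 _ e0; have [dlo dhi] := d0 _ e0.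
apply: Qhalf; have -> : rscal 2 * (c * d + rscal (e * e)) =
   (c - rscal (0 - e)) * (d - rscal (0 - e)) +
   (rscal (0 + e) - c) * (rscal (0 + e) - d) by ring.
by apply: QD; exact: QM.
Qed.

Lemma value0M c d : has_value c 0 -> has_value d 0 -> has_value (c * d) 0.
Proof.
have lo c' d' : has_value c' 0 -> has_value d' 0 -> forall e,
  0 < e -> Q (c' * d' + rscal e).
  move=> c0 d0 e e0; have := value0M_lo c0 d0 (e := Num.sqrt e).
  by rewrite -expr2 sqr_sqrtr ?(ltW e0)// sqrtr_gt0; exact.
move=> c0 d0 e e0; split.
  by rewrite (_ : _ - _ = c * d + rscal e); [exact: lo|ring].
rewrite (_ : _ - _ = - c * d + rscal e); last by ring.
by apply: lo => //; rewrite -oppr0; exact: valueN.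
Qed.

Lemma value0_rscalM c r : has_value c 0 -> has_value (rscal r * c) 0.
Proof.
have pos c' r' : 0 < r' -> has_value c' 0 -> has_value (rscal r' * c') 0.
  move=> r0 c0 e e0; have [f f0 ->] : exists2 f, 0 < f & e = r' * f.
    by exists (e / r'); [exact: divr_gt0|rewrite mulrC divfK// gt_eqF].
  have [lo hi] := c0 f f0; split.
    rewrite (_ : _ - _ = rscal r' * (c' - rscal (0 - f))); last by ring.
    by apply: QM => //; apply: Qr; exact: ltW.
  rewrite (_ : _ - _ = rscal r' * (rscal (0 + f) - c')); last by ring.
  by apply: QM => //; apply: Qr; exact: ltW.
move=> c0; have [r0|r0|->] := ltgtP r 0; last 1 first.
- by rewrite rmorph0 mul0r -{1}(rmorph0 rscal); exact: value_rscal.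
- rewrite -[r]opprK rmorphN mulNr -oppr0; apply: valueN; apply: pos => //.
  by rewrite oppr_gt0.
- exact: pos.
Qed.

(** Only the differences c - r and d - s, of value 0, matter. A lower bound on
    their product comes from products of elements of Q in [value0M_lo], and
    the upper bound from changing the sign of one factor. *)
Lemma valueM c d r s : has_value c r -> has_value d s ->
  has_value (c * d) (r * s).
Proof.
move=> cr ds.
have c0 : has_value (c - rscal r) 0.
  by rewrite -(subrr r); apply: valueD => //; apply: valueN; exact: value_rscal.
have d0 : has_value (d - rscal s) 0.
  by rewrite -(subrr s); apply: valueD => //; apply: valueN; exact: value_rscal.
have -> : c * d = (c - rscal r) * (d - rscal s) + rscal s * (c - rscal r) +
  rscal r * (d - rscal s) + rscal (r * s) by ring.
have -> : r * s = 0 + 0 + 0 + r * s by ring.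
apply: valueD; last by rewrite !add0r; exact: value_rscal.
by apply: valueD; [apply: valueD; [exact: value0M|]|]; exact: value0_rscalM.
Qed.

Definition value_of c : R := xget 0 [set r | has_value c r].

Lemma value_ofP c : star c = c -> has_value c (value_of c).
Proof.
move=> sc; have [r cr] := value_exists sc; rewrite /value_of.
by case: xgetP => [s _ //|/(_ r)].
Qed.

Lemma value_ofE c r : has_value c r -> value_of c = r.
Proof.
move=> cr; rewrite /value_of; case: xgetP => [s _ cs|/(_ r)//].
exact: value_unique cs cr.
Qed.

Definition total_char x : R[i] := (value_of (re_part x))%:C +
  'i%R * (value_of (im_part x))%:C.

Lemma total_charE a b : star a = a -> star b = b ->
  total_char (a + scal A 'i%R * b) = (value_of a)%:C + 'i%R * (value_of b)%:C.
Proof.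
by move=> sa sb; rewrite /total_char re_part_cart// im_part_cart.
Qed.

Lemma total_char_morph : star_morphism (total_char : A -> R[i]).
Proof.
have ii : 'i%R * 'i%R = -1 :> R[i] by rewrite -expr2 sqrCi.
have vr := value_rscal.
have rC r : star (rscal r) = rscal r := star_rscal r.
have saM := @sa_mul _ _ hC.
split.
- move=> l x y.
  have [a [b [sa sb ->]]] := cartesian hC x.
  have [a' [b' [sa' sb' ->]]] := cartesian hC y.
  pose r := complex.Re l; pose s := complex.Im l.
  have lE : l = r%:C + 'i%R * s%:C by rewrite {1}[l]complexE complexiE.
  have -> : l *: (a + scal A 'i%R * b) + (a' + scal A 'i%R * b') =
      (rscal r * a - rscal s * b + a') +
      scal A 'i%R * (rscal r * b + rscal s * a + b').
    rewrite scalE lE rmorphD rmorphM -/(rscal r) -/(rscal s).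
    have -> : (rscal r + scal A 'i%R * rscal s) * (a + scal A 'i%R * b) =
       rscal r * a + scal A ('i%R * 'i%R) * rscal s * b +
         scal A 'i%R * (rscal r * b + rscal s * a) by ring.
    by rewrite ii; ring.
  have va := value_ofP sa; have vb := value_ofP sb; have va' := value_ofP sa';
    have vb' := value_ofP sb'.
  have sra := saM _ _ (rC r) sa; have srb := saM _ _ (rC r) sb.
  have ssa := saM _ _ (rC s) sa; have ssb := saM _ _ (rC s) sb.
  rewrite (total_charE sa sb) (total_charE sa' sb').
  rewrite total_charE ?starDE ?starN ?sra ?srb ?ssa ?ssb ?sa' ?sb'//.
  rewrite (value_ofE (valueD (valueD (valueM (vr r) va) (valueN (valueM (vr s)
    vb))) va')).
  rewrite (value_ofE (valueD (valueD (valueM (vr r) vb) (valueM (vr s) va))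
    vb')).
  rewrite -[RHS]/(l * ((value_of a)%:C + 'i%R * (value_of b)%:C) +
    ((value_of a')%:C + 'i%R * (value_of b')%:C)).
  rewrite lE.
  transitivity ((r * value_of a)%:C + 'i%R * 'i%R * (s * value_of b)%:C +
    (value_of a')%:C +
    'i%R * ((r * value_of b)%:C + (s * value_of a)%:C + (value_of b')%:C));
      first by rewrite ii; ring.
  by ring.
- have -> : 1 = 1 + scal A 'i%R * 0 by rewrite mulr0 addr0.
  rewrite total_charE ?star0 ?star1// -(rmorph1 rscal) (value_ofE (vr _)).
  by rewrite -(rmorph0 rscal) (value_ofE (vr _)) rmorph0 mulr0 addr0.
- move=> x y.
  have [a [b [sa sb ->]]] := cartesian hC x.
  have [a' [b' [sa' sb' ->]]] := cartesian hC y.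
  have -> : (a + scal A 'i%R * b) * (a' + scal A 'i%R * b') =
     (a * a' - b * b') + scal A 'i%R * (a * b' + b * a').
    transitivity (a * a' + scal A ('i%R * 'i%R) * (b * b') +
      scal A 'i%R * (a * b' + b * a')); first by ring.
    by rewrite ii; ring.
  have va := value_ofP sa; have vb := value_ofP sb; have va' := value_ofP sa';
    have vb' := value_ofP sb'.
  rewrite (total_charE sa sb) (total_charE sa' sb').
  rewrite total_charE ?starDE ?starN ?(saM a) ?(saM b) //.
  rewrite (value_ofE (valueD (valueM va va') (valueN (valueM vb vb')))).
  rewrite (value_ofE (valueD (valueM va vb') (valueM vb va'))).
  rewrite -[RHS]/(((value_of a)%:C + 'i%R * (value_of b)%:C)
    * ((value_of a')%:C + 'i%R * (value_of b')%:C)).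
  transitivity ((value_of a * value_of a')%:C + 'i%R * 'i%R * (value_of b *
    value_of b')%:C +
    'i%R * (value_of a * value_of b' + value_of b * value_of a')%:C);
      first by rewrite ii; ring.
  by ring.
- move=> x; have [a [b [sa sb ->]]] := cartesian hC x.
  have -> : star (a + scal A 'i%R * b) = a + scal A 'i%R * (- b).
    by rewrite starDE starME sa sb star_scal conjCi rmorphN; ring.
  rewrite !total_charE ?starN ?sb //.
  rewrite (value_ofE (valueN (value_ofP sb))).
  rewrite -[RHS]/(((value_of a)%:C + 'i%R * (value_of b)%:C)^*%R).
  by rewrite [in RHS]rmorphD [in RHS]rmorphM /= conjCi !conj_Creal
    ?complex_real// rmorphN mulrN mulNr.
Qed.

Lemma total_char_ge0 a : Q a -> 0 <= total_char a.
Proof.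
move=> Qa; have -> : a = a + scal A 'i%R * 0 by rewrite mulr0 addr0.
rewrite total_charE ?star0 ?Qsa// -(rmorph0 rscal) (value_ofE (value_rscal _)).
rewrite rmorph0 mulr0 addr0 ler0c.
by apply: (value_ge0 Qa); apply: value_ofP; exact: Qsa.
Qed.

End TotalPreordering.

(** * Characters determine the norm *)

Section CharacterTheory.
Context (R : realType) (A : cstarType R).
Implicit Types (m n : character A) (a b x y : A) (l : R[i]).

Lemma charD m x y : m (x + y) = m x + m y.
Proof. by have /(_ 1 x y) := star_morphism_linear (char_morph m);
  rewrite !scale1r. Qed.

Lemma charM m x y : m (x * y) = m x * m y.
Proof. exact: star_morphism_mul (char_morph m) _ _. Qed.

Lemma char1 m : m 1 = 1.
Proof. exact: star_morphism_unit (char_morph m). Qed.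

Lemma char_star m x : m (star x) = (m x)^*.
Proof. exact: star_morphism_star (char_morph m) _. Qed.

Lemma char0 m : m 0 = 0.
Proof. by apply: (addrI (m 0)); rewrite -charD !addr0. Qed.

Lemma charN m x : m (- x) = - m x.
Proof. by apply: (addrI (m x)); rewrite -charD !subrr char0. Qed.

Lemma charB m x y : m (x - y) = m x - m y.
Proof. by rewrite charD charN. Qed.

Lemma charZ m l x : m (l *: x) = l * m x.
Proof.
by have := star_morphism_linear (char_morph m) l x 0; rewrite char0 !addr0.
Qed.

Lemma char_scal m l : m (scal A l) = l.
Proof. by rewrite /scal charZ char1 mulr1. Qed.

Lemma char_inj m n : (forall x, m x = n x) -> m = n.
Proof.
case: m n => [f fm] [g gm] /= fg; have fgE : f = g by apply/funext.
by case: _ / fgE gm => gm; congr Character; exact: Prop_irrelevance.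
Qed.

Lemma char_real m a : star a = a -> m a \is Num.real.
Proof. by move=> sa; rewrite CrealE -char_star sa. Qed.

Lemma char_starM m x : m (star x * x) = `|m x| ^+ 2.
Proof. by rewrite charM char_star mulrC -normCK. Qed.

Lemma char_square_ge0 m a : square a -> 0 <= m a.
Proof. by case=> b sb ->; rewrite -[b in b * _]sb char_starM exprn_ge0. Qed.

Hypothesis hC : forall a b : A, a * b = b * a.
#[local] HB.instance Definition _ := GRing.PzRing_hasCommutativeMul.Build A hC.

Lemma starM_sa x : star (star x * x) = star x * x.
Proof. by rewrite starME starK. Qed.

(** The image of |h| - h, a square, is nonnegative, where h has image
    |m x| ^+ 2 and norm |x| ^+ 2. *)
Lemma char_norm m x : `|m x| <= `|x|.
Proof.
rewrite -(ler_pXn2r (n := 2)) ?nnegrE// -char_starM -norm_starM -subr_ge0.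
rewrite -{1}(char_scal m `|_|) -charB; apply: char_square_ge0.
exact: (norm_sub_square hC (starM_sa x)).
Qed.

Lemma starM_square x : square (star x * x).
Proof.
have [a [b [sa sb ->]]] := cartesian hC x.
have -> : star (a + scal A 'i * b) = a - scal A 'i * b.
  by rewrite starDE starME sa sb star_scal conjCi rmorphN; ring.
have -> : (a - scal A 'i * b) * (a + scal A 'i * b) =
    a * a - (scal A 'i * scal A 'i) * (b * b) by ring.
rewrite scal_i2 mulN1r opprK; apply: (squareD hC); [by exists a|by exists b].
Qed.

(** A character attached to an ordering in which h - t is nonnegative, where
    t := |h|, sends h to at least t. Such an ordering exists unless
    -1 = p + (h - t) q with squares p and q. With K >= q a positive scalar,
    this would give (t - h) K >= (t - h) q = 1 + p >= 1, so h <= t - 1 / K,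
    contradicting |h| = t. *)
Lemma char_attains_norm x : x != 0 -> exists m : character A, `|x| <= `|m x|.
Proof.
move=> x0; pose h := star x * x; pose t := `|h|.
have sh : star h = h := starM_sa x.
have sqh : square h := starM_square x.
have t0 : 0 < t by rewrite /t norm_starM exprn_gt0// normr_gt0.
pose T := [set y | exists p q, [/\ square p, square q &
  y = p + (h - scal A t) * q]].
have sq0 : square (0 : A) by rewrite -(rmorph0 (scal A)); exact: square_scal.
have sq1 : square (1 : A) by rewrite -(rmorph1 (scal A)); exact: square_scal.
have sk : star (h - scal A t) = h - scal A t by rewrite starB sh star_real//
  ltW.
have tD : square (scal A t - h) := norm_sub_square hC sh.
have preT : preordering T.
  split.
  - move=> _ [p [q [Pp Pq ->]]].
    by rewrite starDE (square_sa hC Pp) (sa_mul hC sk (square_sa hC Pq)).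
  - by move=> a sqa; exists a, 0; split => //; ring.
  - move=> _ _ [p [q [Pp Pq ->]]] [p' [q' [Pp' Pq' ->]]].
    by exists (p + p'), (q + q'); split; [exact: squareD|exact: squareD|ring].
  - move=> _ _ [p [q [Pp Pq ->]]] [p' [q' [Pp' Pq' ->]]].
    exists (p * p' + ((h - scal A t) * (h - scal A t)) * (q * q')),
      (p * q' + q * p').
    split; last by ring.
    + apply: (squareD hC); apply: (squareM hC) => //; last exact: squareM.
      by exists (h - scal A t).
    + by apply: (squareD hC); exact: squareM.
  - move=> [p [q [Pp Pq pq]]]; pose K := `|q| + t^-1.
    have ti0 : 0 < t^-1 by rewrite invr_gt0.
    have K0 : 0 < K by rewrite ltr_wpDl.
    (* The summand t^-1 of K keeps the bound t - K^-1 nonnegative, as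
       norm_le_order requires. *)
    have KtP : 0 <= t - K^-1.
      by rewrite subr_ge0 -[leRHS]invrK lef_pV2 ?posrE// lerDr.
    suff : t <= t - K^-1 by rewrite lerDl oppr_ge0 invr_le0 lt_geF.
    apply: (norm_le_order hC KtP sqh).
    have KE : scal A K^-1 * scal A K = 1 by rewrite -rmorphM mulVf ?gt_eqF//
      rmorph1.
    have -> : scal A (t - K^-1) - h = scal A K^-1 * ((scal A t - h)
      * scal A K - 1).
      rewrite mulrBr mulrCA KE rmorphB; ring.
    apply: (squareM hC); first by apply: square_scal; rewrite invr_ge0 ltW.
    have -> : (scal A t - h) * scal A K - 1 = (scal A t - h) * (scal A K - q)
      + p.
      have -> : -1 = p + (h - scal A t) * q by [].
      by ring.
    apply: (squareD hC) => //; apply: (squareM hC) => //.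
    have -> : scal A K - q = (scal A `|q| - q) + scal A t^-1 by rewrite /K;
      ring.
    apply: (squareD hC); last by apply: square_scal; exact: ltW.
    by apply: (norm_sub_square hC); exact: square_sa.
have [Q [preQ TQ maxQ]] := maximal_preordering preT.
pose m := Character (total_char_morph hC preQ maxQ); exists m.
have : 0 <= m (h - scal A t).
  apply: (total_char_ge0 hC preQ maxQ); apply: TQ.
  by exists 0, 1; split => //; ring.
rewrite charB char_scal subr_ge0 /h char_starM /t norm_starM.
by rewrite ler_pXn2r ?nnegrE.
Qed.

End CharacterTheory.

(** * Compactness of the character space *)

Section ComplexTopology.
Context (R : realType).
Local Open Scope complex_scope.

Lemma norm_realc (x : R) : `|x%:C| = `|x|%:C :> R[i].
Proof. by rewrite normc_def /= expr0n addr0 sqrtr_sqr. Qed.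

Lemma realc_continuous : continuous (fun x : R => x%:C : R[i]).
Proof.
move=> x; apply/cvgrPdist_lt => e e0.
have eR : e = (complex.Re e)%:C by rewrite RRe_real// gtr0_real.
have e0' : 0 < complex.Re e by rewrite -ltcR -eR.
apply: filterS (nbhsx_ballx x _ e0') => y.
by rewrite -ball_normE /= -rmorphB norm_realc eR ltcR.
Qed.

Lemma norm_Re_le (z : R[i]) : `|complex.Re z|%:C <= `|z|.
Proof. exact: normc_ge_Re. Qed.

Lemma norm_Im_le (z : R[i]) : `|complex.Im z|%:C <= `|z|.
Proof.
have := normc_ge_Re (z * 'i%C).
by rewrite ReiNIm normrN complexiE normrM normCi mulr1.
Qed.

Lemma Re_continuous : continuous (@complex.Re R : R[i] -> R).
Proof.
move=> z; apply/(@cvgrPdist_lt _ _ _ _ (nbhs_filter z)) => e e0.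
have e0' : 0 < e%:C :> R[i] by rewrite ltcR.
apply: filterS (nbhsx_ballx z _ e0') => w.
rewrite -ball_normE /= => zw; rewrite -ltcR -raddfB.
exact: le_lt_trans (norm_Re_le _) zw.
Qed.

Lemma conj_continuous : continuous (Num.conj : R[i] -> R[i]).
Proof.
move=> z; apply/(@cvgrPdist_lt _ _ _ _ (nbhs_filter z)) => e e0.
apply: filterS (nbhsx_ballx z _ e0) => w.
by rewrite -ball_normE /= -rmorphB norm_conjC.
Qed.

(** The compact set is the square of side 2 r, an image of a product of real
    segments. *)
Lemma disc_sub_compact (r : R) : exists2 K : set R[i], compact K &
  forall z, `|z| <= r%:C -> K z.
Proof.
pose S := `[- r, r]%classic `*` `[- r, r]%classic.
pose f (p : R * R) : R[i] := p.1%:C + 'i%R * p.2%:C.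
exists (f @` S).
  apply: continuous_compact; last by apply: compact_setX;
    exact: segment_compact.
  apply: continuous_subspaceT => p; apply: cvgD.
    by apply: (cvg_comp _ _ cvg_fst); exact: realc_continuous.
  by apply: cvgM; [exact: cvg_cst|apply: (cvg_comp _ _ cvg_snd);
    exact: realc_continuous].
move=> z zr; exists (complex.Re z, complex.Im z); last first.
  by rewrite /f /= [RHS]complexE complexiE.
split; rewrite /= in_itv /= -ler_norml -lecR; apply: le_trans zr.
  exact: norm_Re_le.
exact: norm_Im_le.
Qed.

End ComplexTopology.

Section Ultrafilters.

(** A cluster point is a limit, since an ultrafilter contains the preimage of
    each set or of its complement. *)
Lemma ultra_compact_cvg (T : Type) (X : topologicalType) (F : set_system T)
    (f : T -> X) (K : set X) :
  UltraFilter F -> compact K -> (forall t, K (f t)) ->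
  exists z : X, f @ F --> z.
Proof.
move=> FU cK fK; have [|z [_ zF]] := cK (f @ F) _.
  by rewrite /fmap /=; apply: filterE => t; exact: fK.
exists z => U zU /=.
have [//|FnU] := in_ultra_setVsetC (f @^-1` U) FU.
by have [y []] := zF (~` U) U FnU zU.
Qed.

End Ultrafilters.

Section CharacterSpaceCompact.
Context (R : realType) (A : cstarType R).
Hypothesis hC : forall a b : A, a * b = b * a.
Local Open Scope complex_scope.

Lemma char_cvg (F : set_system (character A)) (m : character A) : Filter F ->
  (forall a, (fun n : character A => n a) @ F --> m a) -> F --> m.
Proof.
move=> FF Fm.
have cvF : (@char_fun R A : character A -> {ptws A -> R[i]}) @ F -->
    (char_fun m : {ptws A -> R[i]}).
  exact/(@pointwise_cvgP A R[i]).
move=> U /= [_ [[B Bop <-] Bm sBU]].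
have FB : F ((@char_fun R A : character A -> {ptws A -> R[i]}) @^-1` B).
  by apply: cvF; apply: open_nbhs_nbhs.
exact: filterS sBU FB.
Qed.

(** Along an ultrafilter, m a stays in a compact set for each a, so it has a
    limit. The pointwise limit satisfies the equations of a character. *)
Lemma compact_character : compact [set: character A].
Proof.
rewrite compact_ultra => F FU _.
have cv a : exists z : R[i], (fun m : character A => m a : R[i]) @ F --> z.
  have [K cK KP] := disc_sub_compact (complex.Re `|a|).
  apply: ultra_compact_cvg cK _ => m; apply: KP.
  by rewrite RRe_real ?normr_real//; exact: char_norm.
pose g a : R[i] := projT1 (cid (cv a)).
have gP a : (fun m : character A => m a : R[i]) @ F --> g a.
  exact: projT2 (cid (cv a)).
have gU a z : (fun m : character A => m a : R[i]) @ F --> z -> g a = z.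
  by move=> az; apply: cvg_unique (gP a) az => //; exact: norm_hausdorff.
have gm : star_morphism (g : A -> R[i]).
  split.
  - move=> l x y; apply: gU.
    rewrite (_ : (fun _ => _) = (fun m : character A => l * m x + m y)).
      by apply: cvgD => //; apply: cvgM => //; exact: cvg_cst.
    by apply/funext => m; rewrite charD charZ.
  - apply: gU; rewrite (_ : (fun _ => _) = (fun m : character A => 1)).
      exact: cvg_cst.
    by apply/funext => m; rewrite char1.
  - move=> x y; apply: gU; rewrite (_ : (fun _ => _) = (fun m :
      character A => m x * m y)).
      exact: cvgM.
    by apply/funext => m; rewrite charM.
  - move=> x; apply: gU; rewrite (_ : (fun _ => _) = (fun m :
      character A => Num.conj (m x))).
      by apply: (cvg_comp _ _ (gP x)); exact: conj_continuous.
    by apply/funext => m; rewrite char_star.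
exists (Character gm); split => //; apply: char_cvg => a; exact: gP.
Qed.

End CharacterSpaceCompact.

(** * Approximation by lattices of functions *)

Section KakutaniStone.
Context (R : realType) (X : topologicalType).

(** The complements of the sets satisfying P form a filter. Were it proper, it
    would have a cluster point x, which is excluded by a neighborhood of x
    satisfying P. *)
Lemma compact_induction (P : set X -> Prop) : compact [set: X] ->
  P set0 -> (forall U V, U `<=` V -> P V -> P U) ->
  (forall U V, P U -> P V -> P (U `|` V)) ->
  (forall x : X, exists2 U, nbhs x U & P U) -> P setT.
Proof.
move=> cX P0 Psub PU Ploc; apply: contrapT => nPT.
pose F : set_system X := [set U | P (~` U)].
have FF : ProperFilter F.
  split; first by rewrite /F /= setC0.
  split; first by rewrite /F /= setCT.
  - by move=> U V FU FV; rewrite /F /= setCI; exact: PU.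
  - by move=> U V UV; apply: Psub; exact: subsetC.
have [|x [_ xF]] := cX F FF; first by rewrite /F /= setCT.
have [U xU PUx] := Ploc x.
by have [|y []] := xF (~` U) U _ xU; first by rewrite /F /= setCK.
Qed.

(** First x is fixed and functions close to f at x and y are combined by minima
    over finitely many y, which gives a function below f + e everywhere and
    above f - e at x. Then maxima over finitely many x give the result. The
    finite covers are hidden in [compact_induction]. *)
Lemma kakutani_stone (L : set (X -> R)) (f : X -> R) : compact [set: X] ->
  L !=set0 -> (forall g, L g -> continuous g) -> continuous f ->
  (forall g h, L g -> L h -> L (g \min h) /\ L (g \max h)) ->
  (forall x y e, 0 < e ->
    exists g, [/\ L g, `|f x - g x| < e & `|f y - g y| < e]) ->
  forall e, 0 < e -> exists2 g, L g & forall x, `|f x - g x| < e.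
Proof.
move=> cX [g0 Lg0] Lc fc Llat Lsep e e0.
have nearlt (g h : X -> R) x : continuous g -> continuous h ->
    g x < h x -> nbhs x [set z | g z < h z].
  move=> gc hc gh; have /cvgrPdist_lt cv : (h \- g) @ x --> (h \- g) x.
    by apply: cvgB; [exact: hc|exact: gc].
  have := cv (h x - g x); rewrite subr_gt0 => /(_ gh); apply: filterS => z /=.
  by move/(le_lt_trans (ler_norm _)); rewrite gtrDl oppr_lt0 subr_gt0.
have addc (g : X -> R) : continuous g -> continuous (fun z => g z + e).
  by move=> gc x; apply: cvgD; [exact: gc|exact: cvg_cst].
have below g x : L g -> g x < f x + e -> nbhs x [set z | g z < f z + e].
  by move=> /Lc gc; apply: nearlt => //; exact: addc.
have above g x : L g -> f x < g x + e -> nbhs x [set z | f z < g z + e].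
  by move=> /Lc gc; apply: nearlt => //; exact: addc.
have step1 x : exists g, [/\ L g, f x < g x + e & forall z, g z < f z + e].
  pose P (U : set X) :=
    exists g, [/\ L g, f x < g x + e & forall z, U z -> g z < f z + e].
  have [||||g [Lg gx gT]] := @compact_induction P cX; last by exists g;
    split => // z; exact: gT.
  - have [g [Lg + _]] := Lsep x x e e0; rewrite ltr_distl => /andP[_ gx].
    by exists g.
  - by move=> U V UV [g [Lg gx gV]]; exists g; split => // z /UV; exact: gV.
  - move=> U V [g [Lg gx gU]] [h [Lh hx hV]]; exists (g \min h).
    split; first exact: (Llat _ _ Lg Lh).1.
      by rewrite /= minElt; case: ifP.
    by move=> z [/gU|/hV] lt; apply: le_lt_trans lt;
      rewrite /= ge_min lexx ?orbT.
  - move=> y; have [g [Lg]] := Lsep x y e e0.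
    rewrite !ltr_distl => /andP[_ gx] /andP[gy _].
    exists [set z | g z < f z + e]; last by exists g.
    by apply: below => //; rewrite -ltrBlDr.
pose P (U : set X) :=
  exists g, [/\ L g, (forall z, g z < f z + e)
              & forall z, U z -> f z < g z + e].
have [||||g [Lg gT fT]] := @compact_induction P cX; last first.
- by exists g => // z; rewrite ltr_distl ltrBlDr gT fT.
- move=> x; have [g [Lg gx gT]] := step1 x.
  by exists [set z | f z < g z + e]; [exact: above|exists g].
- move=> U V [g [Lg gT gU]] [h [Lh hT hV]]; exists (g \max h).
  split; first exact: (Llat _ _ Lg Lh).2.
    by move=> z; rewrite /= maxElt; case: ifP.
  by move=> z [/gU|/hV] lt; apply: lt_le_trans lt _;
    rewrite lerD2r /= le_max lexx ?orbT.
- by move=> U V UV [g [Lg gT gV]]; exists g; split => // z /UV; exact: gV.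
- have [[x _]|X0] := pselect ([set: X] !=set0).
    by have [g [Lg _ gT]] := step1 x; exists g.
  by exists g0; split => // z; case: X0; exists z.
Qed.

End KakutaniStone.

(** * Functions realized by a cone of selfadjoint elements *)

Section GelfandTransform.
Context (R : realType) (A : cstarType R).
Hypothesis hC : forall a b : A, a * b = b * a.
#[local] HB.instance Definition _ := GRing.PzRing_hasCommutativeMul.Build A hC.
Local Open Scope complex_scope.
Implicit Types (m n : character A) (a b x y : A) (S : set A).

Lemma norm_le_char x (M : R[i]) : 0 <= M ->
  (forall m, `|m x| <= M) -> `|x| <= M.
Proof.
move=> M0 xM; have [->|x0] := eqVneq x 0; first by rewrite normr0.
by have [m xm] := char_attains_norm hC x0; exact: le_trans xm (xM m).
Qed.

Lemma char_ext x y : (forall m, m x = m y) -> x = y.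
Proof.
move=> xy; apply/eqP; rewrite -subr_eq0 -normr_le0; apply: norm_le_char => // m.
by rewrite charB xy subrr normr0.
Qed.

Lemma gelfand_isometry (cX : compact [set: character A]) x :
  `|gelfand cX x| = `|x|.
Proof.
apply/eqP; rewrite eq_le; apply/andP; split.
  by apply: (cfun_norm_le (normr_ge0 x)) => m; exact: char_norm.
apply: norm_le_char; first exact: normr_ge0.
by move=> m; exact: (cfun_norm_ge (gelfand cX x) m).
Qed.

Lemma Re_char m a : star a = a -> (complex.Re (m a))%:C = m a.
Proof. by move=> sa; apply: RRe_real; exact: char_real. Qed.

(** A first construction of the absolute value, from the square root of
    [ball_sqrt]. It makes no reference to spectra, which are not yet known to
    consist of values of characters. *)
Lemma abs_realized x : exists b, [/\ star b = b, b * b = star x * x &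
  forall m, m b = `|m x|].
Proof.
have sqh := starM_square hC x.
have [s [d [s0 sd d1 hE]]] :=
  ball_sqrt hC (normr_ge0 _) (starM_sa x) (square_ball hC sqh (lexx _)).
exists (scal A s * (1 - d)); split => //.
  by apply: (sa_mul hC); [exact: star_real|rewrite starB star1 sd].
move=> m; have mb0 : 0 <= m (scal A s * (1 - d)).
  rewrite charM char_scal mulr_ge0// charB char1 subr_ge0.
  apply: le_trans (real_ler_norm (char_real m sd)) _.
  exact: le_trans (char_norm hC m d) d1.
apply/eqP; rewrite -(@eqrXn2 _ 2)//; apply/eqP.
by rewrite expr2 -charM -hE char_starM.
Qed.

(** The transform is isometric, so approximants of f come from a Cauchy
    sequence in the closed set S. *)
Lemma uniform_limit_realized S (f : character A -> R) : closed S ->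
  (forall e : R, 0 < e ->
    exists2 a, S a & forall m, `|m a - (f m)%:C| < e%:C) ->
  exists2 a, S a & forall m, m a = (f m)%:C.
Proof.
move=> clS app.
have /choice [a aP] k :
    exists a, S a /\ forall m, `|m a - (f m)%:C| < (k.+1%:R^-1)%:C.
  by have [|a Sa am] := app k.+1%:R^-1; [rewrite invr_gt0|exists a].
have arch (e : R[i]) : 0 < e ->
    exists k, forall j, (k <= j)%N -> (j.+1%:R^-1)%:C < e.
  move=> e0; have eR : e = (complex.Re e)%:C by rewrite RRe_real// gtr0_real.
  have e0' : 0 < complex.Re e by rewrite -ltcR -eR.
  have [k _ kP] := near_infty_natSinv_lt (PosNum e0').
  by exists k => j kj; rewrite eR ltcR; exact: kP.
have acv : cvgn a.
  apply: cauchy_cvg; apply: cauchy_exP => e e0.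
  have e20 : 0 < e / 2 / 2 by rewrite !divr_gt0.
  have [k kP] := arch _ e20; exists (a k), k => // j /= kj.
  rewrite -ball_normE /=; apply: (@le_lt_trans _ _ (e / 2)); last first.
    by rewrite ltr_pdivrMr// ltr_pMr// ltr1n.
  apply: norm_le_char => [|m]; first by rewrite ltW// divr_gt0.
  have -> : m (a k - a j) = (m (a k) - (f m)%:C) - (m (a j) - (f m)%:C).
    by rewrite charB; ring.
  apply: le_trans (ler_normB _ _) _; rewrite [leRHS]splitr; apply: lerD;
    apply: ltW.
    by apply: lt_trans ((aP k).2 m) _; exact: kP.
  by apply: lt_trans ((aP j).2 m) _; exact: kP.
pose l := lim (a @ \oo); have al : a @ \oo --> l by exact: acv.
exists l => [|m].
  have aS : \forall k \near \oo, S (a k) by near=> k; exact: (aP k).1.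
  exact: (closed_cvg S clS aS l al).
apply/eqP; rewrite -subr_eq0 -normr_le0; apply/ler_addgt0Pr => e e0;
  rewrite add0r.
have e20 : 0 < e / 2 by rewrite divr_gt0.
have [k kP] := arch _ e20.
move/cvgrPdist_lt/(_ _ e20): (al) => [k' _ k'P].
pose j := maxn k k'.
have -> : m l - (f m)%:C = m (l - a j) + (m (a j) - (f m)%:C).
  by rewrite charB; ring.
apply: le_trans (ler_normD _ _) _; rewrite [leRHS]splitr; apply: lerD;
  apply: ltW.
  apply: le_lt_trans (char_norm hC _ _) _; apply: k'P; exact: leq_maxr.
apply: lt_trans ((aP j).2 m) _; apply: kP; exact: leq_maxl.
Unshelve. all: by end_near. Qed.

(** If f m < f n then n is not below m, so some c in S has m c < n c, and a
    nonnegative multiple of c plus a constant takes the values f m and f n. *)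
Lemma isotone_realized S (f : character A -> R) :
  closed S -> S `<=` @selfadjoint R A ->
  (forall a b, S a -> S b -> S (a + b)) ->
  (forall (l : R) a, 0 <= l -> S a -> S (l%:C *: a)) ->
  (forall r : R, S (scal A r%:C)) ->
  (forall a b, S a -> S b ->
    (exists2 c, S c & forall m, complex.Re (m c) =
       Num.min (complex.Re (m a)) (complex.Re (m b))) /\
    (exists2 c, S c & forall m, complex.Re (m c) =
       Num.max (complex.Re (m a)) (complex.Re (m b)))) ->
  isotone_cts (char_le S) f -> exists2 a, S a & forall m, m a = (f m)%:C.
Proof.
move=> clS Ssa SD SZ Sc Slat [fc fle]; apply: uniform_limit_realized clS _ =>
  e e0.
pose L := [set g : character A -> R | exists2 a, S a &
  g = fun m => complex.Re (m a)].
have two m n : f m < f n ->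
    exists2 a, S a & complex.Re (m a) = f m /\ complex.Re (n a) = f n.
  move=> fmn.
  have [c Sc' mc] : exists2 c, S c & complex.Re (m c) < complex.Re (n c).
    apply: contrapT => nc; move: fmn; rewrite ltNge => /negP; apply.
    apply: fle; apply/asboolP => c Sc'.
    rewrite -Re_char ?Ssa// -[in leRHS]Re_char ?Ssa// lecR leNgt.
    by apply/negP => mnc; apply: nc; exists c.
  set p := complex.Re (m c) in mc *; set q := complex.Re (n c) in mc *.
  have qp : q - p != 0 by rewrite gt_eqF// subr_gt0.
  pose k := (f n - f m) / (q - p).
  have k0 : 0 <= k by rewrite divr_ge0// subr_ge0 ltW.
  exists (k%:C *: c + scal A (f m - k * p)%:C); first by apply: SD;
    [exact: SZ|exact: Sc].
  have E m' : complex.Re (m' (k%:C *: c + scal A (f m - k * p)%:C)) =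
      k * complex.Re (m' c) + (f m - k * p).
    by rewrite charD charZ char_scal -(Re_char m' (Ssa _ Sc'))
      -rmorphM -rmorphD.
  rewrite !E -/p -/q; split; first by ring.
  by rewrite /k; field.
have [|||m n d d0|g [a Sa ->] ga] := @kakutani_stone _ _ L f
  (compact_character hC) _ _ fc _ _ e e0.
- by exists (fun m => complex.Re (m (scal A 0%:C))); exists (scal A 0%:C).
- move=> _ [a Sa ->] m; apply: (continuous_comp (f :=
    fun n : character A => n a)).
    exact: char_eval_cts.
  exact: Re_continuous.
- move=> _ _ [a Sa ->] [b Sb ->]; have [[c Sc' cE] [d Sd dE]] := Slat _ _ Sa Sb.
  by split; [exists c|exists d] => //; apply/funext => m /=; rewrite ?cE ?dE.
- suff [a Sa [am an]] : exists2 a, S a & complex.Re (m a) = f m /\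
    complex.Re (n a) = f n.
    exists (fun m => complex.Re (m a)); rewrite am an !subrr normr0.
    by split => //; exists a.
  have [|/two [a Sa []]|fmn] := ltgtP (f m) (f n); [exact: two|by exists a|].
  exists (scal A (f m)%:C); first exact: Sc.
  by rewrite !char_scal /= -fmn.
exists a => // m; rewrite -(Re_char m (Ssa _ Sa)) -rmorphB norm_realc ltcR
  distrC.
exact: ga.
Qed.

End GelfandTransform.

(** * Surjectivity, spectra and absolute values *)

Section Spectra.
Context (R : realType) (A : cstarType R).
Hypothesis hC : forall a b : A, a * b = b * a.
#[local] HB.instance Definition _ := GRing.PzRing_hasCommutativeMul.Build A hC.
Local Open Scope complex_scope.
Implicit Types (m n : character A) (a b x y : A) (S : set A).

Lemma closed_selfadjoint : closed (@selfadjoint R A).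
Proof.
have star_cts : continuous (@star R A).
  move=> x; apply/(@cvgrPdist_lt _ _ _ _ (nbhs_filter x)) => e e0.
  apply: filterS (nbhsx_ballx x _ e0) => y.
  by rewrite -ball_normE /= -starB norm_star.
have -> : @selfadjoint R A = (fun x => star x - x) @^-1` [set 0].
  apply/seteqP; split => x /=; first by move=> ->; rewrite subrr.
  by move/eqP; rewrite subr_eq0 => /eqP.
apply: preimage_closed => [x _|]; last
  exact/accessible_closed_set1/hausdorff_accessible/norm_hausdorff.
by apply: cvgB; [exact: star_cts|exact: cvg_id].
Qed.

(** The element [d] is left free: it is the one of [abs_realized] before
    spectra are determined, and cabs (a - b) afterwards. *)
Lemma join_realized a b d : star a = a -> star b = b ->
  (forall m, m d = `|m (a - b)|) -> forall m,
  complex.Re (m (scal A 2^-1 * (a + b) + scal A 2^-1 * d)) =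
  Num.max (complex.Re (m a)) (complex.Re (m b)).
Proof.
move=> sa sb md m; rewrite charD !charM !char_scal charD md charB.
rewrite -(Re_char m sa) -(Re_char m sb) -rmorphB norm_realc -mulrDr -!rmorphD.
have -> : (2^-1 : R[i]) = (2^-1)%:C by rewrite fmorphV rmorph_nat.
by rewrite -rmorphM maxr_absE [in RHS]mulrC.
Qed.

Lemma meet_realized a b d : star a = a -> star b = b ->
  (forall m, m d = `|m (a - b)|) -> forall m,
  complex.Re (m (scal A 2^-1 * (a + b) - scal A 2^-1 * d)) =
  Num.min (complex.Re (m a)) (complex.Re (m b)).
Proof.
move=> sa sb md m; rewrite charB !charM !char_scal charD md charB.
rewrite -(Re_char m sa) -(Re_char m sb) -rmorphB norm_realc -mulrBr -rmorphD
  -rmorphB.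
have -> : (2^-1 : R[i]) = (2^-1)%:C by rewrite fmorphV rmorph_nat.
by rewrite -rmorphM minr_absE [in RHS]mulrC.
Qed.

(** [isotone_realized] for the cone of all selfadjoint elements. This cone is
    stable under opposites and spans the algebra, so the order it defines on
    characters is equality and every function is isotone. *)
Lemma real_realized (f : character A -> R) : continuous f ->
  exists2 a, star a = a & forall m, m a = (f m)%:C.
Proof.
move=> fc; apply: (isotone_realized hC closed_selfadjoint) => //.
- by move=> a b sa sb; rewrite /selfadjoint /= starDE sa sb.
- move=> l a l0 sa; rewrite /selfadjoint /= scalE.
  by apply: (sa_mul hC) => //; apply: star_real; rewrite ler0c.
- by move=> r; rewrite /selfadjoint /= star_scal conj_Creal// complex_real.
- move=> a b sa sb; have [d [sd _ md]] := abs_realized hC (a - b).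
  have sh : star (scal A 2^-1) = scal A 2^-1 by rewrite star_real// invr_ge0.
  have sab : star (a + b) = a + b by rewrite starDE sa sb.
  split.
    exists (scal A 2^-1 * (a + b) - scal A 2^-1 * d); last exact: meet_realized.
    by rewrite /selfadjoint /= starB !(sa_mul hC).
  exists (scal A 2^-1 * (a + b) + scal A 2^-1 * d); last exact: join_realized.
  by rewrite /selfadjoint /= starDE !(sa_mul hC).
- split => // m n /asboolP mn; suff -> : m = n by [].
  apply: char_inj => x; have [a [b [sa sb ->]]] := cartesian hC x.
  have eq c : star c = c -> m c = n c.
    move=> sc; apply: le_anti; rewrite mn //= -lerN2 -!charN mn//.
    by rewrite /selfadjoint /= starN sc.
  by rewrite !charD !charM (eq a)// (eq b)// !char_scal.
Qed.

Lemma gelfand_surj (F : character A -> R[i]) : continuous F ->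
  exists x, forall m, m x = F m.
Proof.
move=> Fc.
have [|a sa aF] := @real_realized (fun m => complex.Re (F m)).
  by move=> m; apply: (continuous_comp (f := F)); [exact: Fc|exact:
    Re_continuous].
have [|b sb bF] := @real_realized (fun m => complex.Re (- 'i%R * F m)).
  move=> m; apply: (continuous_comp (f := fun n => - 'i%R * F n)).
    exact: (cvgMr (Fc m)).
  exact: Re_continuous.
exists (a + scal A 'i%R * b) => m; rewrite charD charM char_scal aF bF.
rewrite [RHS]complexE complexiE; congr (_ + _ * _%:C).
by rewrite mulNr mulrC -complexiE raddfN /= ReiNIm opprK.
Qed.

Lemma char_neq0_invertible x : (forall m, m x != 0) -> invertible x.
Proof.
move=> x0; have [|y yE] := @gelfand_surj (fun m => (m x)^-1).
  by move=> m; exact: (cvgV (x0 m) (@char_eval_cts R A x m)).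
exists y; rewrite (hC y x); suff -> : x * y = 1 by [].
by apply: (char_ext hC) => m; rewrite charM yE char1 mulfV.
Qed.

Lemma char_spectrum m x : spectrum x (m x).
Proof.
move=> [y [xy _]]; have /eqP := char1 m.
by rewrite -xy charM charB -/(scal A (m x)) char_scal subrr mul0r eq_sym
  oner_eq0.
Qed.

Lemma positive_char b : positive b <-> star b = b /\ forall m, 0 <= m b.
Proof.
split=> [[sb sp]|[sb b0]].
  by split => // m; exact: (sp _ (@char_spectrum m b)).
split => // l /= nl; apply: contrapT => l0; apply: nl.
apply: char_neq0_invertible => m; rewrite charB -/(scal A l) char_scal subr_eq0.
by apply/eqP => ml; apply: l0; rewrite -ml.
Qed.

(** [cabs x] is a choice among positive square roots. One exists by
    [abs_realized], and characters determine it since they send positive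
    elements to nonnegative numbers. *)
Lemma char_cabs m x : m (cabs x) = `|m x|.
Proof.
have : exists b, positive b /\ b * b = star x * x.
  have [b [sb bb mb]] := abs_realized hC x; exists b; split => //.
  by apply/positive_char; split => // n; rewrite mb.
move=> /getPex; rewrite -/(csqrt _) -/(cabs x) => -[/positive_char[_ /(_ m)
  c0] cc].
apply/eqP; rewrite -(@eqrXn2 _ 2)//; apply/eqP.
by rewrite expr2 -charM cc char_starM.
Qed.

Lemma char_cmeet m a b : m (cmeet a b) = 2^-1 * (m a +
  m b) - 2^-1 * `|m a - m b|.
Proof. by rewrite charB !charZ charD char_cabs charB. Qed.

Lemma char_cjoin m a b : m (cjoin a b) = 2^-1 * (m a + m b) +
  2^-1 * `|m a - m b|.
Proof. by rewrite charD !charZ charD char_cabs charB. Qed.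

End Spectra.

(** * Transport of isocones *)

Section Evaluation.
Context (R : realType) (X : topologicalType) (cX : compact [set: X]).

Lemma eval_morph (x : X) : star_morphism ((fun f : cfun R cX => f x) :
  cfun R cX -> R[i]).
Proof. by []. Qed.

(** Points as characters: results on the characters of a commutative
    C*-algebra become pointwise statements in its function algebra. *)
Definition eval_char x : character (cfun R cX) := Character (eval_morph x).

Lemma cfun_mulC (f g : cfun R cX) : f * g = g * f.
Proof. by apply: cfunP => x; exact: mulrC. Qed.

End Evaluation.

Section IsometricTransport.
Context (R : realType) (A B : cstarType R) (f : A ->
  B) (s : strength) (I : set A).
Hypotheses (fmor : star_morphism f) (fsurj : forall y, exists x, f x = y).
Hypothesis fiso : forall x, `|f x| = `|x|.
Local Open Scope complex_scope.

Let fD x y : f (x + y) = f x + f y.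
Proof. by have := star_morphism_linear fmor 1 x y; rewrite !scale1r. Qed.

Let f0 : f 0 = 0.
Proof. by apply: (addrI (f 0)); rewrite -fD !addr0. Qed.

Let fZ l x : f (l *: x) = l *: f x.
Proof. by have := star_morphism_linear fmor l x 0; rewrite f0 !addr0. Qed.

Let fB x y : f (x - y) = f x - f y.
Proof. by rewrite -scaleN1r fD fZ scaleN1r. Qed.

Lemma isometric_bijective : bijective f.
Proof.
have /choice [g gK] := fsurj; exists g => // x.
by apply/eqP; rewrite -subr_eq0 -normr_eq0 -fiso fB gK subrr normr0.
Qed.

Lemma isocone_image :
  (forall a b, I a -> I b -> f (cmeet a b) = cmeet (f a) (f b)) ->
  (forall a b, I a -> I b -> f (cjoin a b) = cjoin (f a) (f b)) ->
  isocone s I -> isocone s (f @` I).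
Proof.
move=> fmeet fjoin [[clI saI ID IZ I1 Ilat] dI].
have [g fK gK] := isometric_bijective.
have gc : continuous g.
  move=> y; apply/(@cvgrPdist_lt _ _ _ _ (nbhs_filter y)) => e e0.
  apply: filterS (nbhsx_ballx y _ e0) => z.
  by rewrite -ball_normE /= -[y - z]/(y - z) -{1}(gK y) -{1}(gK z) -fB fiso.
have fc : continuous f.
  move=> x; apply/(@cvgrPdist_lt _ _ _ _ (nbhs_filter x)) => e e0.
  apply: filterS (nbhsx_ballx x _ e0) => z.
  by rewrite -ball_normE /= -fB fiso.
split; first split.
- have -> : f @` I = g @^-1` I.
    apply/seteqP; split => [_ [x Ix <-]|y Igy] /=; first by rewrite fK.
    by exists (g y).
  by apply: preimage_closed clI => y _; exact: gc.
- by move=> _ [x Ix <-]; rewrite /selfadjoint /= -(star_morphism_star fmor) saI.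
- by move=> _ _ [x Ix <-] [y Iy <-]; exists (x + y); [exact: ID|exact: fD].
- by move=> l _ l0 [x Ix <-]; exists (l%:C *: x); [exact: IZ|exact: fZ].
- move=> r; exists (r%:C *: (1 : A)); first exact: I1.
  by rewrite fZ (star_morphism_unit fmor).
- move=> _ _ [x Ix <-] [y Iy <-] xy.
  have [|meetI joinI] := Ilat x y Ix Iy.
    case: (s) xy => // xy.
    by apply: (can_inj fK); rewrite !(star_morphism_mul fmor).
  by split; [exists (cmeet x y)|exists (cjoin x y)] => //;
    [exact: fmeet|exact: fjoin].
move=> O [y Oy] openO.
have [||x [/= Ox [n [l [b [Ib xE]]]]]] := dI (f @^-1` O).
- by exists (g y); rewrite /= gK.
- by apply: open_comp => // z _; exact: fc.
exists (f x); split => //; exists n, l, (fun i => f (b i)); split.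
  by move=> i; exists (b i).
by rewrite xE (big_morph f fD f0); apply: eq_bigr => i _; exact: fZ.
Qed.

End IsometricTransport.

(** * The order defined by an isocone *)

Section GelfandIsocone.
Context (R : realType) (s : strength) (C : cstarType R) (I : set C).
Hypotheses (hI : isocone s I) (hC : forall a b : C, a * b = b * a).
Local Open Scope complex_scope.
Implicit Types (m n : character C) (a b c : C).

Let cX := compact_character hC.

Lemma gelfand_morph : star_morphism (gelfand cX).
Proof.
split.
- by move=> l a b; apply: cfunP => m; exact: star_morphism_linear (char_morph
    m) l a b.
- by apply: cfunP => m; exact: char1.
- by move=> a b; apply: cfunP => m; exact: charM.
- by move=> a; apply: cfunP => m; exact: char_star.
Qed.

Lemma gelfand_onto (F : cfun R cX) : exists a, gelfand cX a = F.
Proof.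
have [a aF] := gelfand_surj hC (@cfun_cts R _ cX F); exists a.
by apply: cfunP => m; exact: aF.
Qed.

Lemma gelfand_cmeet a b : gelfand cX (cmeet a b) = cmeet (gelfand cX a)
  (gelfand cX b).
Proof.
apply: cfunP => m; rewrite -[RHS]/(@eval_char R _ cX m (cmeet _ _)).
rewrite (char_cmeet (@cfun_mulC R _ cX)) -[LHS]/(m (cmeet a b)).
exact: char_cmeet.
Qed.

Lemma gelfand_cjoin a b : gelfand cX (cjoin a b) = cjoin (gelfand cX a)
  (gelfand cX b).
Proof.
apply: cfunP => m; rewrite -[RHS]/(@eval_char R _ cX m (cjoin _ _)).
rewrite (char_cjoin (@cfun_mulC R _ cX)) -[LHS]/(m (cjoin a b)).
exact: char_cjoin.
Qed.

Let preI := isocone_pre hI.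
Let saI := pre_isocone_selfadjoint preI.

Lemma Re_isotone c : I c -> isotone_cts (char_le I) (fun m => complex.Re (m c)).
Proof.
move=> Ic; split.
  move=> m; apply: (continuous_comp (f := fun n : character C => n c)).
    exact: char_eval_cts.
  exact: Re_continuous.
move=> m n /asboolP /(_ c Ic).
by rewrite -(Re_char m (saI Ic)) -(Re_char n (saI Ic)) lecR.
Qed.

Lemma gelfand_image : gelfand cX @` I = isotone_cone R (char_le I) cX.
Proof.
apply/seteqP; split => [_ [c Ic <-]|F [f fI Ff]].
  exists (fun m => complex.Re (m c)); first exact: Re_isotone.
  by move=> m; rewrite Re_char//; exact: saI.
have [|||a b Ia Ib|a Ia af] := isotone_realized hC (pre_isocone_closed preI)
  saI _ _ _ _ fI.
- exact: pre_isocone_add preI.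
- exact: pre_isocone_scale preI.
- exact: pre_isocone_const preI.
- have [|meetI joinI] := pre_isocone_lattice preI Ia Ib;
    first by case: (s) => //; exact: hC.
  have md m : m (cabs (a - b)) = `|m (a - b)| by exact: char_cabs.
  split; [exists (cmeet a b) => // m|exists (cjoin a b) => // m].
    by rewrite /cmeet !scalE; apply: meet_realized => //; exact: saI.
  by rewrite /cjoin !scalE; apply: join_realized => //; exact: saI.
by exists a => //; apply: cfunP => m; rewrite Ff -af.
Qed.

(** Two characters that agree on I agree on its complex span, which is dense,
    and both are contractions. *)
Lemma char_le_separates m n : (forall c, I c -> m c = n c) -> m = n.
Proof.
move=> mn; apply: char_inj => x; apply/eqP; rewrite -subr_eq0 -normr_le0.
apply/ler_addgt0Pr => e e0; rewrite add0r.
have e20 : 0 < e / 2 by rewrite divr_gt0.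
have [||y [xy [k [l [b [Ib yE]]]]]] := @isocone_dense _ _ _ _ hI (ball x (e /
  2)).
- by exists x; exact: ballxx.
- exact: ball_open.
have mny : m y = n y.
  rewrite yE (big_morph m (charD m) (char0 m)) (big_morph n (charD n)
    (char0 n)).
  by apply: eq_bigr => i _; rewrite !charZ mn.
have -> : m x - n x = m (x - y) - n (x - y) by rewrite !charB mny; ring.
move: xy; rewrite -ball_normE /= => /ltW xy.
apply: le_trans (ler_normB _ _) _; rewrite [e]splitr.
by apply: lerD; apply: le_trans xy; exact: char_norm.
Qed.

Lemma char_le_toposet : toposet R (char_le I).
Proof.
have le_refl : reflexive (char_le I) by move=> m; apply/asboolP => c _.
split => //.
- move=> m n /andP[/asboolP mn /asboolP nm]; apply: char_le_separates => c Ic.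
  by apply: le_anti; rewrite mn ?nm.
- move=> n m p /asboolP mn /asboolP np; apply/asboolP => c Ic.
  exact: le_trans (mn c Ic) (np c Ic).
move=> m n; split => [mn f [_ fle]|mn]; first exact: fle.
apply/asboolP => c Ic; have := mn _ (Re_isotone Ic).
by rewrite -lecR !Re_char//; exact: saI.
Qed.

End GelfandIsocone.

Unset Implicit Arguments.

Theorem theorem17 (R : realType) (s : strength) (C : cstarType R)
    (I : set C) (hI : isocone s I) (hC : forall a b : C, a * b = b * a) :
  exists cX : compact [set: character C],
    [/\ toposet R (char_le I),
        isocone s (isotone_cone R (char_le I) cX),
        Istar_isomorphism I (isotone_cone R (char_le I) cX) (gelfand cX)
      & forall c : C, `|gelfand cX c| = `|c| ].
Proof.
exists (compact_character hC).
have iso := gelfand_isometry hC (compact_character hC).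
have mor := gelfand_morph hC.
split => //.
- exact: (char_le_toposet hI hC).
- rewrite -(gelfand_image hI hC); apply: isocone_image => //.
  + exact: gelfand_onto.
  + by move=> a b _ _; exact: gelfand_cmeet.
  + by move=> a b _ _; exact: gelfand_cjoin.
- split; last exact: (gelfand_image hI hC).
  by split => //; apply: isometric_bijective => //; exact: gelfand_onto.
Qed.
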